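(* Assume (M), (J1), (J2), (J3), (F1)–(F5). Then there exists a unique bounded viscosity solution $u$ of (E), and $u$ is bounded and uniformly continuous on $\mathbb{R}^N$. Likewise, under (M), (J1), (J2), (J3) and (F5) (with $F(u,p,\ell)=u-\ell$), there exists a unique bounded uniformly continuous viscosity solution of (Q).
   Context: Let $N,P\ge1$. Let $\mu_1,\mu_2$ be non-negative Radon measures on $\mathbb{R}^P\setminus\{0\}$, $j_1,j_2:\mathbb{R}^N\times\mathbb{R}^P\to\mathbb{R}^N$ Borel measurable, $F:\mathbb{R}\times\mathbb{R}^N\times\mathbb{R}\to\mathbb{R}$, $f:\mathbb{R}^N\to\mathbb{R}$. For bounded measurable $u$, $p,x\in\mathbb{R}^N$: $L_1[u,p](x)=\int_{|z|>0}\big(u(x+j_1(p,z))-u(x)-j_1(p,z)\cdot p\big)d\mu_1(z)$, $L_2[u,p](x)=\int_{|z|>0}\big(u(x+j_2(p,z))-u(x)\big)d\mu_2(z)$; for $\delta>0$, $L_\delta[\phi,D\phi](x)$ is the $L_1$-integral with $p=D\phi(x)$ over $0<|z|<\delta$ and $L^\delta[u,p](x)$ the $L_1$-integral over $|z|\ge\delta$; $L[u,Du](x)=L_1[u,Du(x)](x)+L_2[u,Du(x)](x)$. Equations: (E) $F(u,Du,L[u,Du])=f$ in $\mathbb{R}^N$; (Q) $-L[u,Du]+u=f$ in $\mathbb{R}^N$. A modulus of continuity is a subadditive $\omega:[0,\infty)\to[0,\infty)$ with $\omega(0^+)=0$. (M): $\int|z|^2d\mu_1+\int d\mu_2<\infty$.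 (J1): $j_1,j_2$ continuous in $p$ for a.e. $z$; for each $r>0$, $\sup_{|p|<r}\int|j_1(p,z)|^2d\mu_1<\infty$. (J2): for each $r>0$ a modulus $\omega_{j,r}$ with $\int|j_1(p,z)-j_1(q,z)|^2d\mu_1\le\omega_{j,r}(|p-q|)$ for $|p|,|q|<r$. (J3): there is $\delta_0>0$ such that for all $r>0$, $\varepsilon>0$ there is $\eta>0$ with $\sup_{|p|<r}\int_A|j_1(p,z)|^2d\mu_1(z)<\varepsilon$ for every Borel $A\subset\{0<|z|<\delta_0\}$ with $\int_A|z|^2d\mu_1<\eta$. (F1): $F$ continuous, $F(u,p,\ell)\ge F(u,p,\ell')$ if $\ell\le\ell'$. (F2): for every $M>0$ there is $\gamma_M>0$ with $F(u,p,\ell)-F(v,p,\ell)\ge\gamma_M(u-v)$ for $-M\le v\le u\le M$. (F3): for every $M,r>0$ a modulus $\omega_{M,r}$ with $|F(u,p,\ell)-F(u,q,\ell')|\le\omega_{M,r}(|p-q|+|\ell-\ell'|)$ for $|u|\le M$, $|p|,|q|,|\ell|,|\ell'|\le r$. (F4): $f$ uniformly continuous. (F5): $f$ bounded and uniformly continuous, and $\gamma_M,\omega_{M,r}$ independent of $M$. Viscosity solutions: a bounded usc $u$ is a subsolution of (E) if for every $\delta>0$, $C^2$ $\phi$ and global maximum point $x$ of $u-\phi$: $F(u(x),D\phi(x),L_\delta[\phi,D\phi](x)+L^\delta[u,D\phi(x)](x)+L_2[u,D\phi(x)](x))\le f(x)$; supersolution: bounded lsc, reverse inequality at global minima; solution: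 bounded continuous, both. *)

(* Defs.v *)
From HB Require Import structures.
From mathcomp Require Import all_boot all_order all_algebra.
From mathcomp Require Import all_classical all_reals all_analysis.
Set Implicit Arguments. Unset Strict Implicit. Unset Printing Implicit Defensive.
Import Order.TTheory GRing.Theory Num.Theory.
Import numFieldNormedType.Exports.
Local Open Scope classical_set_scope.
Local Open Scope ring_scope.

Section Defs.
Variable R : realType.

Definition dotv n (a b : 'rV[R]_n) : R := \sum_(i < n) a 0 i * b 0 i.
Definition enorm n (a : 'rV[R]_n) : R := Num.sqrt (dotv a a).

Definition borelRV n := g_sigma_algebraType (@open 'rV[R]_n).

Definition borel_measurable (S T : topologicalType) (g : S -> T) :=
  forall U : set T, open U -> <<s @open S >> (g @^-1` U).

(* non-negative Radon measure on R^P \ {0}, seen as a Borel measure on R^P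
   carrying no mass at 0 and finite on compact subsets of R^P \ {0} *)
Definition radon_punctured P (mu : {measure set (borelRV P) -> \bar R}) :=
  mu [set (0 : 'rV[R]_P)] = 0%E /\
  forall K : set 'rV[R]_P, compact K -> K `<=` [set z | z != 0] ->
    (mu K < +oo)%E.

Definition modulus (w : R -> R) :=
  (forall t, 0 <= t -> 0 <= w t) /\
  (forall s t, 0 <= s -> 0 <= t -> w (s + t) <= w s + w t) /\
  (w t @[t --> 0^'+] --> 0).

Definition boundedf (T : Type) (u : T -> R) := exists M, forall x, `|u x| <= M.

Definition unif_cont n (u : 'rV[R]_n -> R) :=
  forall e, 0 < e -> exists2 d, 0 < d &
    forall x y, enorm (x - y) < d -> `|u x - u y| < e.

Definition usc n (u : 'rV[R]_n -> R) :=
  forall x e, 0 < e -> \forall y \near x, u y < u x + e.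
Definition lsc n (u : 'rV[R]_n -> R) :=
  forall x e, 0 < e -> \forall y \near x, u x - e < u y.

Definition evec n (i : 'I_n) : 'rV[R]_n := delta_mx 0 i.
Definition partial n (i : 'I_n) (g : 'rV[R]_n -> R) (x : 'rV[R]_n) : R :=
  'D_(evec i) g x.
Definition C2 n (g : 'rV[R]_n -> R) :=
  continuous g /\
  forall i : 'I_n,
    (forall x, derivable g x (evec i)) /\ continuous (partial i g) /\
    forall k : 'I_n,
      (forall x, derivable (partial i g) x (evec k)) /\
      continuous (partial k (partial i g)).
Definition grad n (g : 'rV[R]_n -> R) (x : 'rV[R]_n) : 'rV[R]_n :=
  \row_i partial i g x.

Section Nonlocal.
Variables (N P : nat).
Variables (mu1 mu2 : {measure set (borelRV P) -> \bar R}).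
Variables (j1 j2 : 'rV[R]_N -> 'rV[R]_P -> 'rV[R]_N).

Definition punct : set (borelRV P) := [set z | 0 < enorm (z : 'rV[R]_P)].
Definition ball0 (d : R) : set (borelRV P) :=
  [set z | 0 < enorm (z : 'rV[R]_P) < d].
Definition far0 (d : R) : set (borelRV P) :=
  [set z | d <= enorm (z : 'rV[R]_P)].

Definition integ1 (u : 'rV[R]_N -> R) (p x : 'rV[R]_N) (z : borelRV P) : R :=
  u (x + j1 p z) - u x - dotv (j1 p z) p.
Definition integ2 (u : 'rV[R]_N -> R) (p x : 'rV[R]_N) (z : borelRV P) : R :=
  u (x + j2 p z) - u x.

Definition Lloc (d : R) (phi : 'rV[R]_N -> R) x :=
  Rintegral mu1 (ball0 d) (integ1 phi (grad phi x) x).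
Definition Lfar (d : R) (u : 'rV[R]_N -> R) p x :=
  Rintegral mu1 (far0 d) (integ1 u p x).
Definition L2 (u : 'rV[R]_N -> R) p x :=
  Rintegral mu2 punct (integ2 u p x).

Definition nonlocal_defined (d : R) (phi u : 'rV[R]_N -> R) x :=
  mu1.-integrable (ball0 d) (EFin \o integ1 phi (grad phi x) x) /\
  mu1.-integrable (far0 d) (EFin \o integ1 u (grad phi x) x) /\
  mu2.-integrable punct (EFin \o integ2 u (grad phi x) x).

Variables (F : R -> 'rV[R]_N -> R -> R) (f : 'rV[R]_N -> R).

Definition visc_sub (u : 'rV[R]_N -> R) :=
  boundedf u /\ usc u /\
  forall (d : R) (phi : 'rV[R]_N -> R) (x : 'rV[R]_N),
    0 < d -> C2 phi -> (forall y, u y - phi y <= u x - phi x) ->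
    nonlocal_defined d phi u x ->
    F (u x) (grad phi x)
      (Lloc d phi x + Lfar d u (grad phi x) x + L2 u (grad phi x) x) <= f x.

Definition visc_super (u : 'rV[R]_N -> R) :=
  boundedf u /\ lsc u /\
  forall (d : R) (phi : 'rV[R]_N -> R) (x : 'rV[R]_N),
    0 < d -> C2 phi -> (forall y, u x - phi x <= u y - phi y) ->
    nonlocal_defined d phi u x ->
    F (u x) (grad phi x)
      (Lloc d phi x + Lfar d u (grad phi x) x + L2 u (grad phi x) x) >= f x.

Definition visc_sol (u : 'rV[R]_N -> R) :=
  boundedf u /\ continuous u /\ visc_sub u /\ visc_super u.

End Nonlocal.

Section Assumptions.
Variables (N P : nat).
Variables (mu1 mu2 : {measure set (borelRV P) -> \bar R}).
Variables (j1 j2 : 'rV[R]_N -> 'rV[R]_P -> 'rV[R]_N).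

Definition hypM :=
  (\int[mu1]_(z in @punct P) ((enorm (z : 'rV[R]_P)) ^+ 2)%:E < +oo)%E /\
  (\int[mu2]_(z in @punct P) 1 < +oo)%E.

Definition hypJ1 :=
  {ae mu1, forall z : borelRV P, continuous (fun p => j1 p z)} /\
  {ae mu2, forall z : borelRV P, continuous (fun p => j2 p z)} /\
  forall r, 0 < r ->
    (ereal_sup [set \int[mu1]_(z in @punct P) ((enorm (j1 p z)) ^+ 2)%:E
               | p in [set p | (enorm p < r)%R]] < +oo)%E.

Definition hypJ2 :=
  forall r, 0 < r -> exists w, modulus w /\
    forall p q, enorm p < r -> enorm q < r ->
      (\int[mu1]_(z in @punct P) ((enorm (j1 p z - j1 q z)) ^+ 2)%:E
         <= (w (enorm (p - q)))%:E)%E.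

Definition hypJ3 :=
  exists2 d0, 0 < d0 &
    forall r e, 0 < r -> 0 < e -> exists2 eta, 0 < eta &
      forall A : set (borelRV P), measurable A -> A `<=` @ball0 P d0 ->
        (\int[mu1]_(z in A) ((enorm (z : 'rV[R]_P)) ^+ 2)%:E < eta%:E)%E ->
        (ereal_sup [set \int[mu1]_(z in A) ((enorm (j1 p z)) ^+ 2)%:E
                   | p in [set p | (enorm p < r)%R]] < e%:E)%E.

Variables (F : R -> 'rV[R]_N -> R -> R) (f : 'rV[R]_N -> R).

Definition hypF1 :=
  continuous (fun t : R * 'rV[R]_N * R => F t.1.1 t.1.2 t.2) /\
  forall u p l l', l <= l' -> F u p l >= F u p l'.

Definition hypF2 :=
  forall M, 0 < M -> exists2 g, 0 < g &
    forall u v p l, - M <= v -> v <= u -> u <= M ->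
      F u p l - F v p l >= g * (u - v).

Definition hypF3 :=
  forall M r, 0 < M -> 0 < r -> exists w, modulus w /\
    forall u p q l l', `|u| <= M -> enorm p <= r -> enorm q <= r ->
      `|l| <= r -> `|l'| <= r ->
      `|F u p l - F u q l'| <= w (enorm (p - q) + `|l - l'|).

Definition hypF4 := unif_cont f.

(* (F5): f bounded and uniformly continuous, gamma_M and omega_{M,r}
   independent of M *)
Definition hypF5 :=
  boundedf f /\ unif_cont f /\
  (exists2 g, 0 < g &
    forall M, 0 < M -> forall u v p l, - M <= v -> v <= u -> u <= M ->
      F u p l - F v p l >= g * (u - v)) /\
  (forall r, 0 < r -> exists w, modulus w /\
    forall M, 0 < M -> forall u p q l l', `|u| <= M -> enorm p <= r ->
      enorm q <= r -> `|l| <= r -> `|l'| <= r ->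
      `|F u p l - F u q l'| <= w (enorm (p - q) + `|l - l'|)).

End Assumptions.

End Defs.

(* Main.v *)
(** Viscosity (sub/super)solutions which are continuous can be tested with
    paraboloids only: if [u] is touched from below at [x] by
    [u x + p.a - C|a|^2], the integrand [u(x+j1) - u x - j1.p + C|j1|^2] is
    nonnegative, so the full nonlocal operator makes sense in [(-oo, +oo]] and
    is lower semicontinuous by Fatou's lemma, while [p |-> int |j1(p,.)|^2] is
    upper semicontinuous by (J2).

    Existence is by Perron's method.  The operators are translation invariant,
    so if [v] is a subsolution then so is [v(. + h) - e] as soon as
    [f(x + h) <= f x + gamma e]; hence the supremum of all continuous
    subsolutions below a constant supersolution is uniformly continuous, and no
    semicontinuous envelopes are needed.  It is a subsolution by stability, and
    a supersolution because otherwise it could be raised by a paraboloidal bump.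

    Uniqueness is by doubling the variables with
    [u x - v y - k|x - y|^2 - S psi_t(x)], where
    [psi_t(x) = t|x|^2 / (1 + t|x|^2)].  For fixed [k] the two touching slopes
    converge to a common limit as [t -> 0]; the difference of the [j1]-parts is
    controlled by (J2), that of the [j2]-parts by Fatou's lemma. *)
Require Import Defs.
From HB Require Import structures.
From mathcomp Require Import all_boot all_order all_algebra.
From mathcomp Require Import all_classical all_reals all_analysis.
From mathcomp Require Import measurable_realfun ring lra.
Import Order.TTheory GRing.Theory Num.Theory.
Import numFieldNormedType.Exports.
Local Open Scope classical_set_scope.
Local Open Scope ring_scope.

Set Implicit Arguments.
Unset Strict Implicit.

(** At a touching point the operator may equal [+oo], so two values of it cannot be subtracted.
    Every argument is therefore phrased as a lower bound on a sum of nonnegative integrals, and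
    differences become sums: bounds for a function and for its opposite at one point add up to at
    most 0, and in the comparison the compensated integrands of [- u] and [v] are added. The slope
    enters twice, in the linear term and in the jumps, so moving a touching point changes the jumps
    themselves. This is why slope and jump parameter are separate arguments and why continuity in
    [p] matters everywhere: in mean square for [j1], only pointwise for [j2]. The parameter [k] of
    the doubling need not tend to infinity. The variable [x] enters the equation explicitly only
    through [f], so [k] is fixed once, large enough to bring the two points within a distance at
    which [f] varies little. The slopes then stay bounded, and moduli on bounded sets suffice. *)

(** * Euclidean inner product and norm on row vectors *)

Section Euclid.
Variables (R : realType) (n : nat).
Implicit Types (a b c : 'rV[R]_n).

Lemma dotvC a b : dotv a b = dotv b a.
Proof. by apply: eq_bigr => i _; rewrite mulrC. Qed.

Lemma dotvDl a b c : dotv (a + b) c = dotv a c + dotv b c.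
Proof. by rewrite -big_split; apply: eq_bigr => i _; rewrite mxE mulrDl. Qed.

Lemma dotvDr a b c : dotv c (a + b) = dotv c a + dotv c b.
Proof. by rewrite !(dotvC c) dotvDl. Qed.

Lemma dotvZl k a b : dotv (k *: a) b = k * dotv a b.
Proof. by rewrite mulr_sumr; apply: eq_bigr => i _; rewrite mxE mulrA. Qed.

Lemma dotvZr k a b : dotv a (k *: b) = k * dotv a b.
Proof. by rewrite !(dotvC a) dotvZl. Qed.

Lemma dotvNl a b : dotv (- a) b = - dotv a b.
Proof. by rewrite -scaleN1r dotvZl mulN1r. Qed.

Lemma dotvNr a b : dotv a (- b) = - dotv a b.
Proof. by rewrite !(dotvC a) dotvNl. Qed.

Definition dotvE := (dotvDl, dotvDr, dotvNl, dotvNr, dotvZl, dotvZr).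

Lemma dotv0r a : dotv a 0 = 0.
Proof. by rewrite -(scale0r 0) dotvZr mul0r. Qed.

Lemma dotv_ge0 a : 0 <= dotv a a.
Proof. by apply: sumr_ge0 => i _; rewrite -expr2 sqr_ge0. Qed.

Lemma enorm_ge0 a : 0 <= enorm a.
Proof. exact: sqrtr_ge0. Qed.

Lemma sqr_enorm a : enorm a ^+ 2 = dotv a a.
Proof. by rewrite sqr_sqrtr// dotv_ge0. Qed.

Lemma sqr_coord_le a i : a 0 i ^+ 2 <= dotv a a.
Proof.
rewrite /dotv (bigD1 i)//= expr2 lerDl.
by apply: sumr_ge0 => k _; rewrite -expr2 sqr_ge0.
Qed.

Lemma coord_le_enorm a i : `|a 0 i| <= enorm a.
Proof.
by rewrite -(ler_pXn2r (n := 2))// ?nnegrE ?enorm_ge0// sqr_enorm real_normK ?num_real// sqr_coord_le.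
Qed.

Lemma norm_le_enorm a : `|a| <= enorm a.
Proof.
rewrite /Num.norm/= mx_normrE; apply/bigmax_leP; split; first exact: enorm_ge0.
by move=> [i j] _ /=; rewrite ord1 coord_le_enorm.
Qed.

Lemma dotv_eq0 a : dotv a a = 0 -> a = 0.
Proof.
move=> a0; apply/rowP => i; rewrite mxE; apply/eqP.
by rewrite -sqrf_eq0 eq_le sqr_ge0 andbT -a0 sqr_coord_le.
Qed.

Lemma dotv2_le a b : 2 * dotv a b <= dotv a a + dotv b b.
Proof. by have := dotv_ge0 (a - b); rewrite !dotvE (dotvC b a); lra. Qed.

Lemma dotv_add_le a b : dotv (a + b) (a + b) <= 2 * dotv a a + 2 * dotv b b.
Proof. by have := dotv2_le a b; rewrite !dotvE (dotvC b a); lra. Qed.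

Lemma mx_norm_coord a i : `|a 0 i| <= `|a|.
Proof.
rewrite [leRHS]/Num.norm/= mx_normrE.
by apply: (le_bigmax _ (fun ij : 'I_1 * 'I_n => `|a ij.1 ij.2|) (0, i)).
Qed.

Lemma dotv_le_norm a : dotv a a <= n%:R * `|a| ^+ 2.
Proof.
rewrite /dotv; apply: (@le_trans _ _ (\sum_(i < n) `|a| ^+ 2)).
  apply: ler_sum => i _; rewrite -expr2 -[leLHS]real_normK ?num_real//.
  by rewrite ler_pXn2r// ?nnegrE// mx_norm_coord.
by rewrite sumr_const card_ord mulr_natl.
Qed.

Lemma cvg_dotv (T : Type) (F : set_system T) {FF : Filter F} (f g : T -> 'rV[R]_n) a b :
  f @ F --> a -> g @ F --> b -> dotv (f t) (g t) @[t --> F] --> dotv a b.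
Proof.
move=> cf cg; rewrite /dotv; apply: cvg_big; first by move=> x; apply: cvgD; [exact: cvg_fst|exact: cvg_snd].
move=> i _; apply: cvgM.
- by apply: (@cvg_comp _ _ _ f (fun a => a 0 i) _ _ _ cf); exact: coord_continuous.
- by apply: (@cvg_comp _ _ _ g (fun a => a 0 i) _ _ _ cg); exact: coord_continuous.
Qed.

Lemma cvg_enorm (T : Type) (F : set_system T) {FF : Filter F} (f : T -> 'rV[R]_n) a :
  f @ F --> a -> enorm (f t) @[t --> F] --> enorm a.
Proof.
move=> cf; rewrite /enorm.
exact: (@cvg_comp _ _ _ (fun t => dotv (f t) (f t)) Num.sqrt _ _ _
  (cvg_dotv cf cf) (@sqrt_continuous _ _)).
Qed.

Lemma continuous_enorm : continuous (@enorm R n).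
Proof. by move=> a; exact: (@cvg_enorm _ (nbhs a) _ id a (@cvg_id _ _)). Qed.

Lemma continuous_addr b : continuous (fun a => a + b).
Proof.
move=> a.
exact: (@cvgD _ _ _ (nbhs a) _ id (fun=> b) a b (@cvg_id _ _) (@cvg_cst _ _ _ _ _)).
Qed.

Lemma near_enorm a (e : R) : 0 < e -> \forall b \near a, enorm (b - a) < e.
Proof.
move=> e0; have n0 : (0 : R) < n.+1%:R by rewrite ltr0Sn.
near=> b; rewrite -(ltr_pXn2r (n := 2))// ?nnegrE ?enorm_ge0 ?(ltW e0)//.
rewrite sqr_enorm; apply: (le_lt_trans (dotv_le_norm _)).
have : `|b - a| < e / n.+1%:R.
  by rewrite distrC; near: b; apply: cvgr_dist_lt; [exact: cvg_id|rewrite divr_gt0].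
rewrite -(ltr_pXn2r (n := 2))// ?nnegrE ?divr_ge0 ?(ltW e0)//.
rewrite expr_div_n ltr_pdivlMr ?exprn_gt0//; apply: le_lt_trans.
rewrite mulrC ler_wpM2l ?sqr_ge0// -natrX ler_nat.
by rewrite (leq_trans (leqnSn n))// leq_pmulr.
Unshelve. all: by end_near. Qed.

Lemma cvg_enormP (T : Type) (F : set_system T) {FF : Filter F} (f : T -> 'rV[R]_n) a :
  (forall e, 0 < e -> \forall t \near F, enorm (f t - a) < e) -> f @ F --> a.
Proof.
move=> H; apply/cvgrPdist_lt => e /H; apply: filterS => t.
by rewrite distrC; apply: le_lt_trans; exact: norm_le_enorm.
Qed.

(** At [b = a / (C + 1)] the inequality reads [|a|^2 <= 0] up to a positive factor. This identifies
    slopes: paraboloids touching one function from both sides at a point have the same gradient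
    there. *)
Lemma dotv_le_quadratic a C : 0 <= C -> (forall b, dotv a b <= C * dotv b b) -> a = 0.
Proof.
move=> C0 /(_ ((C + 1)^-1 *: a)); rewrite !dotvE => H; apply: dotv_eq0.
have C1 : 0 < C + 1 by rewrite ltr_wpDl.
move: (dotv_ge0 a) H (mulVf (lt0r_neq0 C1)) (C1); rewrite -invr_gt0.
set k := (C + 1)^-1; set D := dotv a a => D0 H kC k0.
have : k * (k * D) <= 0 by nra.
by rewrite pmulr_rle0// pmulr_rle0// => D1; apply: le_anti; rewrite D1.
Qed.

(** Follows from [|b|^2 <= 2|b - a|^2 + 2|a|^2]. Any bound in terms of [a] alone would do: it puts
    the slopes near a limit into one ball, on which (J2) and (F3) supply a modulus. *)
Lemma enorm_lt_bound a b : enorm (b - a) < 1 -> enorm b < 2 * enorm a + 2.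
Proof.
have a0 := enorm_ge0 a; have ba0 := enorm_ge0 (b - a) => ba1.
rewrite -(ltr_pXn2r (n := 2))// ?nnegrE ?enorm_ge0//; last by lra.
have := dotv_add_le (b - a) a; rewrite subrK -!sqr_enorm.
by nra.
Qed.

End Euclid.

(** * A one-sided form of Fatou's lemma *)

Section Fatou.

Lemma limn_einf_ge_near (R : realType) (u : (\bar R)^nat) (a : R) :
  (forall e, 0 < e -> \forall k \near \oo, ((a - e)%:E <= u k)%E) ->
  (a%:E <= limn_einf u)%E.
Proof.
move=> H; apply/lee_addgt0Pr => e e0; rewrite -leeBlDr//.
rewrite limn_einf_lim; apply: lime_ge; first exact: is_cvg_einfs.
have [k _ Hk] := H e e0; exists k => // i /= ki.
by apply: le_ereal_inf_tmp => _ [l /= il <-]; apply: Hk; exact: leq_trans il.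
Qed.

(** Only an asymptotic lower bound of [f k] by [g] is asked, not convergence; [m] is any number
    strictly below the integral of [g], so that this integral may be infinite. *)
Lemma fatou_near (d : measure_display) (T : measurableType d) (R : realType)
    (mu : {measure set T -> \bar R}) (D : set T) (f : nat -> T -> R) (g : T -> R) (m : \bar R) :
  measurable D -> (forall k, measurable_fun D (f k)) -> measurable_fun D g ->
  (forall k x, D x -> 0 <= f k x) -> (forall x, D x -> 0 <= g x) ->
  {ae mu, forall x, D x -> forall e, 0 < e -> \forall k \near \oo, g x - e <= f k x} ->
  (m < \int[mu]_(x in D) (g x)%:E)%E ->
  \forall k \near \oo, (m <= \int[mu]_(x in D) (f k x)%:E)%E.
Proof.
move=> mD mf mg f0 g0 fg mlt.
have mEf k : measurable_fun D (fun x => (f k x)%:E) by apply/measurable_EFinP.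
have fE0 k x : D x -> (0 <= (f k x)%:E)%E by move=> ?; rewrite lee_fin f0.
have mlim : measurable_fun D (fun x => limn_einf (fun k => (f k x)%:E)).
  have -> : (fun x => limn_einf (fun k => (f k x)%:E)) =
            (fun x => - limn_esup (fun k => - (f k x)%:E))%E.
    apply/funext => x; rewrite -[RHS]limn_einfN; congr limn_einf; apply/funext => k /=.
    by rewrite opprK.
  apply: measurableT_comp => //.
  by apply: measurable_fun_limn_esup => k; exact: measurableT_comp.
have : (m < limn_einf (fun k => \int[mu]_(x in D) (f k x)%:E))%E.
  apply: (lt_le_trans mlt).
  apply: le_trans (fatou mu mD (f := fun k x => (f k x)%:E) mEf fE0).
  apply: ae_ge0_le_integral => //.
  - by apply/measurable_EFinP.
  - by move=> x Dx; rewrite limn_einf_lim; apply: lime_ge;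
      [exact: is_cvg_einfs|near=> k; apply: le_ereal_inf_tmp => _ [l _ <-]; exact: fE0].
  - apply: filterS fg => x fgx Dx; apply: limn_einf_ge_near => e e0.
    by apply: filterS (fgx Dx e e0) => k; rewrite lee_fin.
rewrite limn_einf_lim => mlim'.
have [k mk] : exists k, (m < einfs (fun k => \int[mu]_(x in D) (f k x)%:E) k)%E.
  apply: contrapT => /forallNP nk; move: mlim'; apply/negP; rewrite -leNgt.
  apply: lime_le; first exact: is_cvg_einfs.
  by near=> k; rewrite leNgt; apply/negP; exact: nk.
exists k => // l /= kl; apply: (le_trans (ltW mk)).
by apply: ereal_inf_lbound; exists l.
Unshelve. all: by end_near. Qed.

Lemma ge0_integral_le_lincomb (d : measure_display) (T : measurableType d) (R : realType)
    (mu : {measure set T -> \bar R}) (D : set T) (f g h : T -> R) (a b : R) :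
  measurable D -> measurable_fun D f -> measurable_fun D g -> measurable_fun D h ->
  (forall x, D x -> 0 <= f x) -> (forall x, D x -> 0 <= g x) -> (forall x, D x -> 0 <= h x) ->
  0 <= a -> 0 <= b -> (forall x, D x -> f x <= a * g x + b * h x) ->
  (\int[mu]_(x in D) (f x)%:E <=
     a%:E * \int[mu]_(x in D) (g x)%:E + b%:E * \int[mu]_(x in D) (h x)%:E)%E.
Proof.
move=> mD mf mg mh f0 g0 h0 a0 b0 fgh.
rewrite -!ge0_integralZl_EFin//; try by [move=> x Dx; rewrite lee_fin; auto | apply/measurable_EFinP].
have mk (k : R) (u : T -> R) : measurable_fun D u ->
    measurable_fun D (fun x => k%:E * (u x)%:E)%E.
  by move=> mu'; apply/measurable_EFinP; exact: measurable_funM.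
have kge0 (k : R) (u : T -> R) : 0 <= k -> (forall x, D x -> 0 <= u x) ->
    forall x, D x -> (0 <= k%:E * (u x)%:E)%E.
  by move=> k0 u0 x Dx; rewrite -EFinM lee_fin mulr_ge0// u0.
rewrite -ge0_integralD//; [|exact: kge0|exact: mk|exact: kge0|exact: mk].
apply: ge0_le_integral => //.
- exact/measurable_EFinP.
- by apply: emeasurable_funD; exact: mk.
Qed.

End Fatou.

(** * Measurability of the domains of integration and of the jumps *)

Section Jump.
Variables (R : realType) (N P : nat).

Lemma measurable_open (U : set 'rV[R]_P) :
  open U -> measurable (U : set (borelRV R P)).
Proof. by move=> oU; apply: sub_sigma_algebra. Qed.

Lemma open_enorm_gt (d : R) : open [set z : 'rV[R]_P | d < enorm z].
Proof.
by apply: (@open_comp _ _ (fun z => enorm z) [set r | d < r]); [move=> z _; exact: continuous_enorm|exact: open_gt].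
Qed.

Lemma measurable_punct : measurable (@punct R P).
Proof. by rewrite /punct; apply: measurable_open; exact: open_enorm_gt. Qed.

Lemma measurable_far0 d : measurable (@far0 R P d).
Proof.
have -> : far0 d = ~` ([set z | enorm (z : 'rV[R]_P) < d] : set (borelRV R P)).
  by apply/seteqP; split => z /=; rewrite /far0 /= leNgt => /negP.
apply: measurableC; apply: measurable_open.
by apply: (@open_comp _ _ (fun z => enorm z) [set r | r < d]); [move=> z _; exact: continuous_enorm|exact: open_lt].
Qed.

Lemma measurable_ball0 d : measurable (@Defs.ball0 R P d).
Proof.
have -> : Defs.ball0 d = @punct R P `\` far0 d.
  apply/seteqP; split => z /=; rewrite /Defs.ball0 /punct /far0 /=.
    by case/andP => -> zd; split => //; apply/negP; rewrite -ltNge.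
  by case=> -> /negP; rewrite -ltNge.
exact: measurableD measurable_punct (measurable_far0 d).
Qed.

Lemma punctE d : 0 < d -> @punct R P = Defs.ball0 d `|` far0 d.
Proof.
move=> d0; apply/seteqP; split => z; rewrite /Defs.ball0 /punct /far0 /=.
  by move=> ->; case: (ltP (enorm z) d) => ?; [left|right].
by case=> [/andP[]//|]; exact: lt_le_trans.
Qed.

Lemma ball0_far0_disj d : [disjoint @Defs.ball0 R P d & @far0 R P d].
Proof.
by apply/disj_setPS => z /= [/andP[_]]; rewrite /far0/= ltNge => /negP.
Qed.

Variables (mu : {measure set (borelRV R P) -> \bar R}).
Variable j : 'rV[R]_N -> 'rV[R]_P -> 'rV[R]_N.
Hypothesis hj : borel_measurable (fun pz : 'rV[R]_N * 'rV[R]_P => j pz.1 pz.2).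

Lemma measurable_jump (c : 'rV[R]_N -> R) p (D : set (borelRV R P)) :
  continuous c -> measurable_fun D (fun z => c (j p z)).
Proof.
move=> cc; apply: (measurable_funS measurableT) => //.
(* [B] carries the Borel sets of the product space, for which the joint measurability of [j] is
   stated; the section [z |-> (p, z)] is continuous, hence measurable into it. *)
pose B := g_sigma_algebraType (@open ('rV[R]_N * 'rV[R]_P)%type).
have m1 : measurable_fun setT (fun z : borelRV R P => (p, z : 'rV[R]_P) : B).
  apply: (@measurability _ _ (borelRV R P) B setT (fun z => (p, z : 'rV[R]_P)) (@open ('rV[R]_N * 'rV[R]_P)%type) erefl).
  move=> _ [U oU <-]; rewrite setTI; apply: measurable_open.
  apply: (@open_comp _ _ (fun z : 'rV[R]_P => (p, z)) U) => // z _.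
  exact: (@cvg_pair _ _ _ (nbhs z) (nbhs p) (nbhs z) _ _ _ (fun=> p) id (@cvg_cst _ p _ _ _) (@cvg_id _ _)).
have m2 : measurable_fun setT (fun t : B => c (j t.1 t.2)).
  apply: (@measurability _ _ B (measurableTypeR R) setT (fun t : B => c (j t.1 t.2)) _ (RGenOpens.measurableE R)).
  move=> _ [_ [a [b ->]] <-]; rewrite setTI.
  apply: (hj (U := c @^-1` `]a, b[)).
  by apply: open_comp; [move=> x _; exact: cc|exact: interval_open].
exact: (measurableT_comp m2 m1).
Qed.

End Jump.

(** * Second moment of the jumps and its dependence on the slope *)

Section JumpMoments.
Variables (R : realType) (N P : nat).
Variables (mu1 mu2 : {measure set (borelRV R P) -> \bar R}).
Variables (j1 j2 : 'rV[R]_N -> 'rV[R]_P -> 'rV[R]_N).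
Hypothesis hj1 : borel_measurable (fun pz : 'rV[R]_N * 'rV[R]_P => j1 pz.1 pz.2).
Hypothesis hM : hypM mu1 mu2.
Hypothesis hJ1 : hypJ1 mu1 mu2 j1 j2.
Hypothesis hJ2 : hypJ2 mu1 j1.

Lemma continuous_sqnorm : continuous (fun a : 'rV[R]_N => dotv a a).
Proof. by move=> a; exact: (@cvg_dotv _ _ _ (nbhs a) _ id id a a (@cvg_id _ _) (@cvg_id _ _)). Qed.

Lemma measurable_sqjump p D : measurable_fun D (fun z : borelRV R P => dotv (j1 p z) (j1 p z)).
Proof. by apply: (measurable_jump hj1 (c := fun a => dotv a a)); exact: continuous_sqnorm. Qed.

Lemma measurable_sqjumpB p q D :
  measurable_fun D (fun z : borelRV R P => dotv (j1 p z - j1 q z) (j1 p z - j1 q z)).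
Proof.
rewrite /dotv; apply: measurable_sum => i.
have m k : measurable_fun D (fun z : borelRV R P => j1 k z 0 i).
  by apply: (measurable_jump hj1 (c := fun a => a 0 i)); exact: coord_continuous.
have mm : measurable_fun D (fun z : borelRV R P => (j1 p z - j1 q z) 0 i).
  apply: (eq_measurable_fun (fun z : borelRV R P => j1 p z 0 i - j1 q z 0 i)).
    by move=> z _; rewrite !mxE.
  exact: measurable_funB.
exact: measurable_funM.
Qed.

Definition moment p : \bar R := \int[mu1]_(z in @punct R P) (dotv (j1 p z) (j1 p z))%:E.
Definition jump_moment p : R := fine (moment p).
Definition mass2 : R := fine (mu2 (@punct R P)).

Lemma moment_lty p : (moment p < +oo)%E.
Proof.
have [_ [_ /(_ (enorm p + 1))]] := hJ1; rewrite ltr_wpDl ?enorm_ge0//.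
move=> /(_ isT); apply: le_lt_trans; apply: ereal_sup_ubound.
exists p; first by rewrite /= ltrDl.
by apply: eq_integral => z _; rewrite sqr_enorm.
Qed.

Lemma momentE p : moment p = (jump_moment p)%:E.
Proof.
rewrite /jump_moment fineK// ge0_fin_numE ?moment_lty//.
by apply: integral_ge0 => z _; rewrite lee_fin dotv_ge0.
Qed.

Lemma jump_moment_ge0 p : 0 <= jump_moment p.
Proof.
by rewrite -lee_fin -momentE; apply: integral_ge0 => z _; rewrite lee_fin dotv_ge0.
Qed.

Lemma integral_Zmoment p C : 0 <= C ->
  (\int[mu1]_(z in @punct R P) (C * dotv (j1 p z) (j1 p z))%:E = (C * jump_moment p)%:E)%E.
Proof.
move=> C0; rewrite EFinM -momentE -ge0_integralZl//.
- exact: measurable_punct.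
- by apply/measurable_EFinP; exact: measurable_sqjump.
- by move=> z _; rewrite lee_fin dotv_ge0.
Qed.

Lemma mu2_lty : (mu2 (@punct R P) < +oo)%E.
Proof. by have [_] := hM; rewrite integral_cst ?mul1e//; exact: measurable_punct. Qed.

Lemma mass2E : mu2 (@punct R P) = mass2%:E.
Proof. by rewrite /mass2 fineK// ge0_fin_numE ?mu2_lty. Qed.

Lemma mass2_ge0 : 0 <= mass2.
Proof. by rewrite -lee_fin -mass2E. Qed.

Lemma integral_cst_mu2 (B : R) : (\int[mu2]_(z in @punct R P) B%:E = (B * mass2)%:E)%E.
Proof. by rewrite integral_cst ?mass2E//; exact: measurable_punct. Qed.

Lemma jump_equicontinuous r e : 0 < r -> 0 < e -> exists2 d, 0 < d &
  forall p q, enorm p < r -> enorm q < r -> enorm (p - q) < d ->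
  (\int[mu1]_(z in @punct R P) (dotv (j1 p z - j1 q z) (j1 p z - j1 q z))%:E <= e%:E)%E.
Proof.
move=> r0 e0; have [w [[w0 [_ wc]] Hw]] := hJ2 r0.
have := (@cvgr_lt _ _ _ _ _ _ wc e e0); rewrite near_withinE => -[d /= d0 Hd].
exists d => // p q pr qr pqd.
(* The limit of [w] at 0 is over positive arguments and says nothing about [w 0], so the diagonal is
   settled by hand. *)
have [pq|pq0] := eqVneq p q.
  rewrite pq integral0_eq ?lee_fin ?(ltW e0)// => z _.
  by rewrite subrr dotv0r.
have epq0 : 0 < enorm (p - q).
  rewrite lt_neqAle enorm_ge0 andbT eq_sym -sqrf_eq0 sqr_enorm.
  by apply: contra pq0 => /eqP/dotv_eq0/eqP; rewrite subr_eq0.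
apply: (@le_trans _ _ (w (enorm (p - q)))%:E); last first.
  rewrite lee_fin ltW//; apply: Hd => //=.
  by rewrite sub0r normrN ger0_norm ?enorm_ge0.
apply: le_trans (Hw p q pr qr).
by under eq_integral do rewrite -sqr_enorm.
Qed.

(** Young's inequality [|j q|^2 <= (1 + t)|j p|^2 + (1 + 1/t)|j q - j p|^2], integrated. The moment
    stands on the smaller side of the lower bounds on the operator, so what matters is that it does
    not jump up. *)
Lemma jump_moment_usc p e : 0 < e -> exists2 d, 0 < d & forall q, enorm (q - p) < d -> jump_moment q <= jump_moment p + e.
Proof.
(* The weight [t] costs at most [e / 2] on the moment at [p] (the added 1 covers a vanishing
   moment); the other [e / 2] is left for the difference of the jumps, weighted by [s = 1 + 1/t]. *)
move=> e0; set t := e / 2 / (jump_moment p + 1).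
have Jp1 : 0 < jump_moment p + 1 by rewrite ltr_wpDl ?jump_moment_ge0.
have t0 : 0 < t by rewrite !divr_gt0.
have tJ : t * jump_moment p <= e / 2.
  by rewrite /t mulrAC ler_pdivrMr// ler_pM2l ?divr_gt0// lerDl.
set s := 1 + t^-1; have s0 : 0 < s by rewrite ltr_wpDl ?ltr01// invr_gt0.
have s1 : 0 < e / 2 / s by rewrite !divr_gt0.
have r0 : 0 < 2 * enorm p + 2 by rewrite ltr_wpDl ?mulr_ge0 ?enorm_ge0.
have [d d0 Hd] := jump_equicontinuous r0 s1.
exists (Num.min d 1); first by rewrite lt_min d0/=.
move=> q; rewrite lt_min => /andP[qd q1].
have qr := enorm_lt_bound q1.
have pr : enorm p < 2 * enorm p + 2 by have := enorm_ge0 p; lra.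
have := Hd q p qr pr qd.
set I := (X in (X <= _)%E) => HI.
have t1 : 0 <= 1 + t by rewrite addr_ge0// ltW.
have : (moment q <= (1 + t)%:E * moment p + s%:E * I)%E.
  apply: ge0_integral_le_lincomb => //; try by [move=> z _; exact: dotv_ge0|exact: ltW].
  - exact: measurable_punct.
  - exact: measurable_sqjump.
  - exact: measurable_sqjump.
  - exact: measurable_sqjumpB.
  move=> z _.
  have := dotv_ge0 (t *: j1 p z - (j1 q z - j1 p z)).
  rewrite !dotvE !(dotvC (j1 q z) (j1 p z)) /s.
  set A := dotv _ _; set B := dotv _ _; set D := dotv _ _ => H.
  rewrite -subr_ge0 -(pmulr_rge0 _ t0).
  apply: le_trans H _; rewrite le_eqVlt; apply/orP; left; apply/eqP.
  by field; rewrite gt_eqF.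
rewrite !momentE => H.
have : ((jump_moment q)%:E <= ((1 + t) * jump_moment p + s * (e / 2 / s))%:E)%E.
  apply: (le_trans H); rewrite [leRHS]EFinD [X in (_ <= _ + X)%E]EFinM [X in (_ <= X + _)%E]EFinM.
  by apply: leeD => //; apply: lee_wpmul2l => //; rewrite lee_fin ltW.
rewrite lee_fin => /le_trans; apply.
rewrite mulrCA divff ?gt_eqF// mulr1; lra.
Qed.


End JumpMoments.

(** * The nonlocal operator on functions touched from below by a paraboloid *)

Section Touching.
Variables (R : realType) (N P : nat).
Implicit Types (g : 'rV[R]_N -> R) (x q p a : 'rV[R]_N) (B C m : R).

(** One formula for both integrands: [B = 0] gives the [j1] integrand compensated by [C|a|^2], while
    [C = 0] and [q = 0] give the [j2] integrand raised by the constant [B]. *)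
Definition gap C B g x q a := C * dotv a a + B + (g (x + a) - g x) - dotv q a.

(** The paraboloid [g x + q.a - C|a|^2] lies below [g] everywhere and meets it at [x]. The last
    clause says that [g] drops by at most [B] from its value at [x], the only trace of boundedness
    that is kept. *)
Definition touch g x q C B :=
  [/\ 0 <= C, forall a, 0 <= gap C 0 g x q a & forall a, 0 <= gap 0 B g x 0 a].

Lemma gap_osc B g x a : gap 0 B g x 0 a = B + (g (x + a) - g x).
Proof. by rewrite /gap mul0r add0r (dotvC 0) dotv0r subr0. Qed.

Lemma gap_cvg C B g x q a (xn qn an : nat -> 'rV[R]_N) :
  continuous g -> xn @ \oo --> x -> qn @ \oo --> q -> an @ \oo --> a ->
  gap C B g (xn k) (qn k) (an k) @[k --> \oo] --> gap C B g x q a.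
Proof.
move=> cg cx cq ca; rewrite /gap; apply: cvgB; last exact: cvg_dotv.
apply: cvgD.
  apply: cvgD; last exact: cvg_cst.
  by apply: cvgM; [exact: cvg_cst|exact: cvg_dotv].
apply: cvgB.
  apply: (@cvg_comp _ _ _ (fun k => xn k + an k) g _ (nbhs (x + a))); last exact: cg.
  exact: cvgD.
exact: (@cvg_comp _ _ _ xn g _ (nbhs x) _ cx (cg x)).
Qed.

Lemma gap_continuous C B g x q : continuous g -> continuous (gap C B g x q).
Proof.
move=> cg a; rewrite /gap.
have cd : {for a, continuous (fun b => dotv q b)}.
  exact: (@cvg_dotv _ _ _ (nbhs a) _ (fun=> q) id q a (@cvg_cst _ _ _ _ _) (@cvg_id _ _)).
have cgx : {for a, continuous (fun b => g (x + b))}.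
  apply: (@continuous_comp _ _ _ (fun b => x + b) g); last exact: cg.
  by apply: (@cvgD _ _ _ (nbhs a) _ (fun=> x) id x a (@cvg_cst _ _ _ _ _) (@cvg_id _ _)).
apply: (@cvgB _ _ _ (nbhs a)) => //; apply: (@cvgD _ _ _ (nbhs a)).
  apply: (@cvgD _ _ _ (nbhs a)); last exact: cvg_cst.
  apply: (@cvgM _ _ (nbhs a)); [exact: cvg_cst|exact: continuous_sqnorm].
by apply: (@cvgB _ _ _ (nbhs a)); [exact: cgx|exact: cvg_cst].
Qed.

Variables (mu1 mu2 : {measure set (borelRV R P) -> \bar R}).
Variables (j1 j2 : 'rV[R]_N -> 'rV[R]_P -> 'rV[R]_N).

Definition gap_int1 g x q p C : \bar R := \int[mu1]_(z in @punct R P) (gap C 0 g x q (j1 p z))%:E.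
Definition gap_int2 g x p B : \bar R := \int[mu2]_(z in @punct R P) (gap 0 B g x 0 (j2 p z))%:E.

(* [m] is at most the value of the whole nonlocal operator on [g] at [x], for
   the slope [q] and the jumps of parameter [p]; since the [C|j1|^2] and [B]
   compensations make both integrands nonnegative, this makes sense even when
   the operator takes the value [+oo]. *)
Definition nonlocal_ge g x q p C B m : Prop :=
  ((m + C * jump_moment mu1 j1 p + B * mass2 mu2)%:E <= gap_int1 g x q p C + gap_int2 g x p B)%E.

Hypothesis hj1 : borel_measurable (fun pz : 'rV[R]_N * 'rV[R]_P => j1 pz.1 pz.2).
Hypothesis hj2 : borel_measurable (fun pz : 'rV[R]_N * 'rV[R]_P => j2 pz.1 pz.2).
Hypothesis hM : hypM mu1 mu2.
Hypothesis hJ1 : hypJ1 mu1 mu2 j1 j2.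
Hypothesis hJ2 : hypJ2 mu1 j1.

Lemma measurable_gap1 C B g x q p D : continuous g ->
  measurable_fun D (fun z : borelRV R P => gap C B g x q (j1 p z)).
Proof. by move=> cg; apply: (measurable_jump hj1); exact: gap_continuous. Qed.

Lemma measurable_gap2 C B g x q p D : continuous g ->
  measurable_fun D (fun z : borelRV R P => gap C B g x q (j2 p z)).
Proof. by move=> cg; apply: (measurable_jump hj2); exact: gap_continuous. Qed.

(** For opposite slopes and one jump parameter, increments and linear terms of the two integrands
    cancel; what remains is [(C + C')|j1|^2] and [B + B'], whose finite integrals are the
    compensations on the left. This stands in for [L[- g] = - L[g]]. *)
Lemma below_add g x q p C B m C' B' m' : continuous g ->
  touch g x q C B -> touch (\- g) x (- q) C' B' ->
  nonlocal_ge g x q p C B m -> nonlocal_ge (\- g) x (- q) p C' B' m' -> m + m' <= 0.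
Proof.
move=> cg [C0 t1 t2] [C'0 t1' t2'] H H'.
have cNg : continuous (\- g) by move=> y; exact: (@cvgN _ _ _ (nbhs y) _ g _ (cg y)).
have mP := @measurable_punct R P.
have := leeD H H'; rewrite -EFinD addeACA /gap_int1 /gap_int2.
rewrite -[X in (_ <= X + _)%E]ge0_integralD//; last 4 first.
- by move=> z _; rewrite lee_fin; exact: t1.
- by apply/measurable_EFinP; exact: measurable_gap1.
- by move=> z _; rewrite lee_fin; exact: t1'.
- by apply/measurable_EFinP; exact: measurable_gap1.
rewrite -[X in (_ <= _ + X)%E]ge0_integralD//; last 4 first.
- by move=> z _; rewrite lee_fin; exact: t2.
- by apply/measurable_EFinP; exact: measurable_gap2.
- by move=> z _; rewrite lee_fin; exact: t2'.
- by apply/measurable_EFinP; exact: measurable_gap2.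
rewrite (eq_integral (fun z : borelRV R P => ((C + C') * dotv (j1 p z) (j1 p z))%:E)); last first.
  by move=> z _; rewrite -EFinD; congr EFin; rewrite /gap dotvNl /=; ring.
rewrite [X in (_ <= _ + X)%E](eq_integral (fun z : borelRV R P => (B + B')%:E)); last first.
  by move=> z _; rewrite -EFinD; congr EFin; rewrite !gap_osc /=; ring.
rewrite (integral_Zmoment hj1 hJ1) ?addr_ge0// (integral_cst_mu2 hM) -EFinD lee_fin.
lra.
Qed.

(** Fatou's lemma is applied to each integral separately and asks for strict finite bounds. An
    infinite integral takes whatever the other cannot supply. *)
Lemma le_adde_fin (I1 I2 : \bar R) (t e : R) : 0 < e -> (0 <= I1)%E -> (0 <= I2)%E ->
  (t%:E <= I1 + I2)%E ->
  exists a1 a2 : R, [/\ (a1%:E < I1)%E, (a2%:E < I2)%E & t - e <= a1 + a2].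
Proof.
move=> e0.
case: I1 => [r1| |]//; case: I2 => [r2| |]// I10 I20 H.
- exists (r1 - e / 2), (r2 - e / 2); rewrite !lte_fin; split; try lra.
  by move: H; rewrite -EFinD lee_fin; lra.
- exists (r1 - e), (t - r1); rewrite !lte_fin ltry; split => //; lra.
- exists (t - r2), (r2 - e); rewrite !lte_fin ltry; split => //; lra.
- exists 0, t; rewrite !ltry; split => //; lra.
Qed.

Lemma below_stable (gn : nat -> 'rV[R]_N -> R) g (xn qn pn : nat -> 'rV[R]_N) x q p C B m e :
  (forall k, continuous (gn k)) -> continuous g -> 
  xn @ \oo --> x -> qn @ \oo --> q -> pn @ \oo --> p ->
  (forall k, touch (gn k) (xn k) (qn k) C B) -> touch g x q C B ->
  (forall k y, g y <= gn k y) -> gn k (xn k) @[k --> \oo] --> g x ->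
  nonlocal_ge g x q p C B m -> 0 < e ->
  \forall k \near \oo, nonlocal_ge (gn k) (xn k) (qn k) (pn k) C B (m - e).
Proof.
move=> cgn cg cx cq cp tn [C0 t1 t2] ggn cgx H e0.
(* Half of [e] pays for splitting the two integrals, half for the growth of [C] times the second
   moment from [p] to [pn k]. *)
have e2 : 0 < e / 2 by rewrite divr_gt0.
have mP := @measurable_punct R P.
have I10 : (0 <= gap_int1 g x q p C)%E by apply: integral_ge0 => z _; rewrite lee_fin; exact: t1.
have I20 : (0 <= gap_int2 g x p B)%E by apply: integral_ge0 => z _; rewrite lee_fin; exact: t2.
have [a1 [a2 [ha1 ha2 ha]]] := le_adde_fin e2 I10 I20 H.
have cgap D E (an : nat -> 'rV[R]_N) a b bn : an @ \oo --> a -> bn @ \oo --> b ->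
    forall d, 0 < d -> \forall k \near \oo,
      gap D E g x b a - d <= gap D E (gn k) (xn k) (bn k) (an k).
  move=> ca cb d d0.
  have h1 : gap D E g x b a - d < gap D E g x b a - (g x - g x) by lra.
  have h2 : gap D E g (xn k) (bn k) (an k) - (gn k (xn k) - g (xn k)) @[k --> \oo] -->
      gap D E g x b a - (g x - g x).
    apply: cvgB; first exact: gap_cvg.
    apply: cvgB => //.
    exact: (@cvg_comp _ _ _ xn g _ (nbhs x) _ cx (cg x)).
  have := @cvgr_gt _ _ _ (@eventually_filter) _ _ h2 _ h1.
  apply: filterS => k; rewrite /gap; have := ggn k (xn k + an k); lra.
have n1 : \forall k \near \oo, (a1%:E <= gap_int1 (gn k) (xn k) (qn k) (pn k) C)%E.
  apply: (fatou_near (f := fun k (z : borelRV R P) => gap C 0 (gn k) (xn k) (qn k) (j1 (pn k) z))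
    (g := fun z : borelRV R P => gap C 0 g x q (j1 p z))) => //.
  - by move=> k; exact: measurable_gap1.
  - exact: measurable_gap1.
  - by move=> k z _; have [_ + _] := tn k; exact.
  - have [+ _] := hJ1; apply: filterS => z cz _ d d0.
    apply: cgap => //.
    exact: (@cvg_comp _ _ _ pn (fun p => j1 p z) _ (nbhs p) _ cp (cz p)).
have n2 : \forall k \near \oo, (a2%:E <= gap_int2 (gn k) (xn k) (pn k) B)%E.
  apply: (fatou_near (f := fun k (z : borelRV R P) => gap 0 B (gn k) (xn k) 0 (j2 (pn k) z))
    (g := fun z : borelRV R P => gap 0 B g x 0 (j2 p z))) => //.
  - by move=> k; exact: measurable_gap2.
  - exact: measurable_gap2.
  - by move=> k z _; have [_ _ +] := tn k; exact.
  - have [_ [+ _]] := hJ1; apply: filterS => z cz _ d d0.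
    apply: cgap => //; last exact: cvg_cst.
    exact: (@cvg_comp _ _ _ pn (fun p => j2 p z) _ (nbhs p) _ cp (cz p)).
have e3 : 0 < e / 2 / (C + 1) by rewrite divr_gt0// ltr_wpDl.
have [d d0 Hd] := jump_moment_usc hj1 hJ1 hJ2 p e3.
have n3 : \forall k \near \oo, jump_moment mu1 j1 (pn k) <= jump_moment mu1 j1 p + e / 2 / (C + 1).
  by near=> k; apply: Hd; near: k; exact: (cp _ (near_enorm p d0)).
have C1 : 0 < C + 1 by rewrite ltr_wpDl.
have Ce : C * (e / 2 / (C + 1)) <= e / 2.
  by rewrite mulrCA ler_piMr ?(ltW e2)// ler_pdivrMr// mul1r lerDl.
apply: filterS3 n1 n2 n3 => k H1 H2 H3; rewrite /nonlocal_ge.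
apply: le_trans (leeD H1 H2); rewrite -EFinD lee_fin.
apply: le_trans ha; have := ler_wpM2l C0 H3; lra.
Unshelve. all: by end_near. Qed.

End Touching.

(** * Monotonicity of the lower bounds; minimisers of parabolic perturbations *)

Section ParabolicSolutions.
Variables (R : realType) (N P : nat).
Variables (mu1 mu2 : {measure set (borelRV R P) -> \bar R}).
Variables (j1 j2 : 'rV[R]_N -> 'rV[R]_P -> 'rV[R]_N).
Implicit Types (g u v : 'rV[R]_N -> R) (x y q p a : 'rV[R]_N) (B C m l : R).

Lemma touch_mono g g' x x' q C B :
  (forall a, g (x + a) - g x <= g' (x' + a) - g' x') ->
  touch g x q C B -> touch g' x' q C B.
Proof.
move=> gg [C0 t1 t2]; split => // a; [have := t1 a|have := t2 a];
  rewrite /gap; have := gg a; lra.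
Qed.

Lemma touch_B_ge0 g x q C B : touch g x q C B -> 0 <= B.
Proof. by case=> _ _ /(_ 0); rewrite gap_osc addr0 subrr addr0. Qed.

Lemma touch_weaken g x q C B C' B' : C <= C' -> B <= B' ->
  touch g x q C B -> touch g x q C' B'.
Proof.
move=> CC BB [C0 t1 t2]; split => [|a|a]; first exact: le_trans CC.
  have := t1 a; rewrite /gap.
  have := ler_wpM2r (dotv_ge0 a) CC; lra.
by have := t2 a; rewrite !gap_osc; lra.
Qed.

Notation below := (nonlocal_ge mu1 mu2 j1 j2).
Hypothesis hj1 : borel_measurable (fun pz : 'rV[R]_N * 'rV[R]_P => j1 pz.1 pz.2).
Hypothesis hj2 : borel_measurable (fun pz : 'rV[R]_N * 'rV[R]_P => j2 pz.1 pz.2).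
Hypothesis hM : hypM mu1 mu2.
Hypothesis hJ1 : hypJ1 mu1 mu2 j1 j2.
Hypothesis hJ2 : hypJ2 mu1 j1.

Lemma below_mono g g' x x' q p C B m : continuous g -> continuous g' ->
  (forall a, g (x + a) - g x <= g' (x' + a) - g' x') ->
  touch g x q C B -> below g x q p C B m -> below g' x' q p C B m.
Proof.
move=> cg cg' gg tg H; have [C0 t1 t2] := tg; have [_ t1' t2'] := touch_mono gg tg.
have mP := @measurable_punct R P.
apply: (le_trans H); apply: leeD; apply: ge0_le_integral => //.
- by move=> z _; rewrite lee_fin; exact: t1.
- by apply/measurable_EFinP; exact: measurable_gap1.
- by apply/measurable_EFinP; exact: measurable_gap1.
- by move=> z _; rewrite lee_fin /gap; have := gg (j1 p z); lra.
- by move=> z _; rewrite lee_fin; exact: t2.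
- by apply/measurable_EFinP; exact: measurable_gap2.
- by apply/measurable_EFinP; exact: measurable_gap2.
- by move=> z _; rewrite lee_fin !gap_osc; have := gg (j2 p z); lra.
Qed.

(** Larger compensations add the same finite quantity to both sides. Stability can thus be applied
    with constants common to a whole sequence. *)
Lemma below_weaken g x q p C B C' B' m : continuous g -> C <= C' -> B <= B' ->
  touch g x q C B -> below g x q p C B m -> below g x q p C' B' m.
Proof.
move=> cg CC BB tg; have [C0 t1 t2] := tg.
have mP := @measurable_punct R P; rewrite /nonlocal_ge.
have -> : gap_int1 mu1 j1 g x q p C' =
    (gap_int1 mu1 j1 g x q p C + ((C' - C) * jump_moment mu1 j1 p)%:E)%E.
  rewrite -(integral_Zmoment hj1 hJ1) ?subr_ge0// -ge0_integralD//.
  - by apply: eq_integral => z _; rewrite -EFinD; congr EFin; rewrite /gap; ring.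
  - by move=> z _; rewrite lee_fin; exact: t1.
  - by apply/measurable_EFinP; exact: measurable_gap1.
  - by move=> z _; rewrite lee_fin mulr_ge0 ?dotv_ge0// subr_ge0.
  - apply/measurable_EFinP; apply: measurable_funM => //; exact: measurable_sqjump.
have -> : gap_int2 mu2 j2 g x p B' =
    (gap_int2 mu2 j2 g x p B + ((B' - B) * mass2 mu2)%:E)%E.
  rewrite -(integral_cst_mu2 hM) -ge0_integralD//.
  - by apply: eq_integral => z _; rewrite -EFinD; congr EFin; rewrite /gap; ring.
  - by move=> z _; rewrite lee_fin; exact: t2.
  - by apply/measurable_EFinP; exact: measurable_gap2.
  - by move=> z _; rewrite lee_fin subr_ge0.
move=> H; rewrite addeACA -EFinD.
have := leeD H (lexx ((C' - C) * jump_moment mu1 j1 p + (B' - B) * mass2 mu2)%:E).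
rewrite -EFinD; apply: le_trans; rewrite lee_fin; lra.
Qed.

Lemma near_enorm_ball (A : set 'rV[R]_N) x : (\forall y \near x, A y) ->
  exists2 d, 0 < d & forall y, enorm (y - x) < d -> A y.
Proof.
move=> /nbhs_ballP[d /= d0 H]; exists d => // y yd; apply: H.
by rewrite -ball_normE/= distrC; apply: le_lt_trans yd; exact: norm_le_enorm.
Qed.

Lemma exists_minimizer (T : topologicalType) (h : T -> R) (K : set T) (t0 : T) :
  compact K -> continuous h -> K t0 -> (forall t, ~ K t -> h t0 <= h t) ->
  exists t, forall s, h t <= h s.
Proof.
move=> cK ch K0 Kh.
have [||t /set_mem Kt Ht] := @compact_EVT_min _ _ h K _ cK.
- by exists t0.
- exact: continuous_subspaceT.
exists t => s; have [Ks|nKs] := pselect (K s); first by apply: Ht; exact: mem_set.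
by apply: le_trans (Kh _ nKs); apply: Ht; exact: mem_set.
Qed.

Lemma compact_sublevel (r : R) x : compact [set y : 'rV[R]_N | dotv (y - x) (y - x) <= r].
Proof.
apply: bounded_closed_compact.
  exists (`|x| + (`|r| + 1)); split; first exact: num_real.
  move=> M Mx y /= yr; apply/ltW/(le_lt_trans _ Mx).
  rewrite -[y in leLHS](subrK x) addrC (le_trans (ler_normD _ _))// lerD2l.
  apply: (le_trans (norm_le_enorm _)).
  rewrite -(ler_pXn2r (n := 2))// ?nnegrE ?enorm_ge0 ?addr_ge0// sqr_enorm.
  have := ler_norm r; have := normr_ge0 r; nra.
have cc : continuous (fun y : 'rV[R]_N => dotv (y - x) (y - x)).
  move=> y; apply: (@cvg_dotv _ _ _ (nbhs y) _ (fun y => y - x) (fun y => y - x));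
  exact: continuous_addr.
by apply: (@closed_comp _ _ (fun y => dotv (y - x) (y - x)) [set s | s <= r]);
  [move=> y _; exact: cc|exact: closed_le].
Qed.

Lemma parabola_minimizer g x p C M : 0 < C -> continuous g -> (forall y, M <= g y) ->
  exists y, forall z, g y + dotv p (y - x) + C * dotv (y - x) (y - x) <=
                      g z + dotv p (z - x) + C * dotv (z - x) (z - x).
Proof.
move=> C0 cg gM; set h := fun y => g y + dotv p (y - x) + C * dotv (y - x) (y - x).
(* Completing the square, [p.d >= - |p|^2 / (2C) - C|d|^2 / 2], so half of the quadratic term
   survives; beyond [|d|^2 = r] it lifts the function above its value at [x]. *)
set r := 2 / C * (g x - M + dotv p p / (2 * C) ).
have ch : continuous h.
  move=> y.
  have cs : {for y, continuous (fun z : 'rV[R]_N => z - x)}.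
    exact: continuous_addr.
  apply: (@cvgD _ _ _ (nbhs y)).
    apply: (@cvgD _ _ _ (nbhs y)); first exact: cg.
    by apply: (@cvg_dotv _ _ _ (nbhs y)); [exact: cvg_cst|exact: cs].
  apply: (@cvgM _ _ (nbhs y)); first exact: cvg_cst.
  by apply: (@cvg_dotv _ _ _ (nbhs y)); exact: cs.
apply: (exists_minimizer (K := [set y | dotv (y - x) (y - x) <= r]) (t0 := x)) => //.
- exact: compact_sublevel.
- rewrite /= subrr dotv0r /r mulr_ge0// ?divr_ge0 ?(ltW C0)//.
  by rewrite addr_ge0 ?subr_ge0// divr_ge0 ?dotv_ge0// mulr_ge0 ?(ltW C0).
- move=> y /negP; rewrite -ltNge /r => yr.
  rewrite /h subrr !dotv0r mulr0 !addr0.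
  move: yr (gM y); move: (y - x) => d yr gMy.
  have := dotv_ge0 (p + C *: d); rewrite !dotvE (dotvC d p).
  set A := dotv p p in yr *; set D := dotv p d; set X := dotv d d in yr *.
  rewrite -(pmulr_rge0 _ (_ : 0 < (2 * C)^-1)) ?invr_gt0 ?mulr_gt0// => H.
  have e1 : (2 * C)^-1 * (A + C * D + (C * D + C * (C * X))) = A / (2 * C) + D + C * X / 2.
    by field; rewrite gt_eqF.
  move: yr; rewrite -(ltr_pM2l (_ : 0 < C / 2)) ?divr_gt0// => yr.
  have e2 : C / 2 * (2 / C * (g x - M + A / (2 * C))) = g x - M + A / (2 * C).
    by field; rewrite gt_eqF.
  by move: H yr; rewrite e1 e2; lra.
Qed.

End ParabolicSolutions.

(** * Perron's method *)

Section Perron.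
Variables (R : realType) (N P : nat).
Variables (mu1 mu2 : {measure set (borelRV R P) -> \bar R}).
Variables (j1 j2 : 'rV[R]_N -> 'rV[R]_P -> 'rV[R]_N).
Variables (F : R -> 'rV[R]_N -> R -> R) (f : 'rV[R]_N -> R).
Implicit Types (g u v : 'rV[R]_N -> R) (x y q p a : 'rV[R]_N) (B C m l : R).

Notation below := (nonlocal_ge mu1 mu2 j1 j2).

(* [u] is touched from above through [- u]: the slope changes sign, the jump
   parameter does not. *)
Definition parabolic_sub u := forall x p C B l, touch (\- u) x (- p) C B ->
  below (\- u) x (- p) p C B (- l) -> F (u x) p l <= f x.

Definition parabolic_super u := forall x p C B l, touch u x p C B ->
  below u x p p C B l -> f x <= F (u x) p l.

Hypothesis hj1 : borel_measurable (fun pz : 'rV[R]_N * 'rV[R]_P => j1 pz.1 pz.2).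
Hypothesis hj2 : borel_measurable (fun pz : 'rV[R]_N * 'rV[R]_P => j2 pz.1 pz.2).
Hypothesis hM : hypM mu1 mu2.
Hypothesis hJ1 : hypJ1 mu1 mu2 j1 j2.
Hypothesis hJ2 : hypJ2 mu1 j1.
Hypothesis Fcont : continuous (fun t : R * 'rV[R]_N * R => F t.1.1 t.1.2 t.2).
Hypothesis Fmono : forall (u : R) p l l', l <= l' -> F u p l' <= F u p l.
Variable gamma : R.
Hypothesis gamma_gt0 : 0 < gamma.
Hypothesis Fgamma : forall (u v : R) p l, v <= u -> gamma * (u - v) <= F u p l - F v p l.
Hypothesis f_uc : unif_cont f.
Variable Mf : R.
Hypothesis f_bound : forall x, `|f x| <= Mf.

Lemma continuousN_fun u : continuous u -> continuous (\- u).
Proof. by move=> cu y; exact: (@cvgN _ _ _ (nbhs y) _ u _ (cu y)). Qed.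

Lemma unif_cont_continuous u : unif_cont u -> continuous u.
Proof.
move=> cu x; apply/(@cvgrPdist_lt _ _ _ (nbhs x) (nbhs_filter x)) => e /cu[d d0 H].
apply: (@filterS _ (nbhs x) (nbhs_filter x) _ _ _ (near_enorm x d0)) => y yd.
by rewrite distrC; exact: H.
Qed.

Lemma cvg_F (un ln : nat -> R) (pn : nat -> 'rV[R]_N) (u : R) p l :
  un @ \oo --> u -> pn @ \oo --> p -> ln @ \oo --> l ->
  F (un k) (pn k) (ln k) @[k --> \oo] --> F u p l.
Proof.
move=> cu cp cl.
have c3 : (un k, pn k, ln k) @[k --> \oo] --> nbhs (u, p, l) by exact: (cvg_pair (cvg_pair cu cp) cl).
exact: (@cvg_comp _ _ _ (fun k => (un k, pn k, ln k))
  (fun t : R * 'rV[R]_N * R => F t.1.1 t.1.2 t.2) _ _ _ c3 (@Fcont (u, p, l))).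
Qed.

Lemma cvg_f (xn : nat -> 'rV[R]_N) x : xn @ \oo --> x -> f (xn k) @[k --> \oo] --> f x.
Proof.
move=> cx; exact: (@cvg_comp _ _ _ xn f _ (nbhs x) _ cx (@unif_cont_continuous f f_uc x)).
Qed.

Lemma cvg_inv_nat (c : R) : c * k.+1%:R^-1 @[k --> \oo] --> (0 : R).
Proof. by rewrite -[X in _ --> X](mulr0 c); apply: cvgM; [exact: cvg_cst|exact: cvg_harmonic]. Qed.

(** Fatou's lemma and the splitting of integrals lose an arbitrarily small [e] in [l]; continuity of
    [F] recovers it. *)
Lemma F_right_le (u : R) p l c : (forall e, 0 < e -> F u p (l + e) <= c) -> F u p l <= c.
Proof.
move=> H.
have cl : l + 1 * k.+1%:R^-1 @[k --> \oo] --> l.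
  by rewrite -[X in _ --> X]addr0; apply: cvgD; [exact: cvg_cst|exact: cvg_inv_nat].
apply: (cvgr_to_le (cvg_F (@cvg_cst _ u _ \oo _) (@cvg_cst _ p _ \oo _) cl)).
by near=> k; apply: H; rewrite mul1r invr_gt0.
Unshelve. all: by end_near. Qed.

Lemma F_left_ge (u : R) p l c : (forall e, 0 < e -> c <= F u p (l - e)) -> c <= F u p l.
Proof.
move=> H.
have cl : l - 1 * k.+1%:R^-1 @[k --> \oo] --> l.
  by rewrite -[X in _ --> X]subr0; apply: cvgB; [exact: cvg_cst|exact: cvg_inv_nat].
apply: (cvgr_to_ge (cvg_F (@cvg_cst _ u _ \oo _) (@cvg_cst _ p _ \oo _) cl)).
by near=> k; apply: H; rewrite mul1r invr_gt0.
Unshelve. all: by end_near. Qed.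

(** Chosen so that [gamma * perron_bound = Mf + |F 0 0 0|]: monotonicity in [u] then pushes [F] at
    the two constants [- perron_bound] and [perron_bound] past [f], which makes them barriers. *)
Definition perron_bound := (Mf + `|F 0 0 0|) / gamma.

Lemma Mf_ge0 : 0 <= Mf.
Proof. exact: le_trans (f_bound 0). Qed.

Lemma perron_bound_ge0 : 0 <= perron_bound.
Proof. by rewrite divr_ge0 ?addr_ge0 ?Mf_ge0// ltW. Qed.

Lemma F_perron_bound x : F (- perron_bound) 0 0 <= f x <= F perron_bound 0 0.
Proof.
have K0 := perron_bound_ge0.
have gK : gamma * perron_bound = Mf + `|F 0 0 0| by rewrite mulrCA divff ?mulr1// gt_eqF.
have H1 := Fgamma 0 0 K0.
have H2 : gamma * (0 - - perron_bound) <= F 0 0 0 - F (- perron_bound) 0 0.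
  by apply: Fgamma; rewrite oppr_le0.
move: H1 H2; rewrite subr0 opprK add0r gK.
have := f_bound x; rewrite ler_norml => /andP[].
have := ler_norm (F 0 0 0); have := ler_norm (- F 0 0 0); rewrite normrN.
by move=> *; apply/andP; split; lra.
Qed.

(** Around a global maximum the increments of [g] are at most those of a constant, so the bound
    passes to a constant, on which the operator vanishes. *)
Lemma below_cst_le g x p C B m : continuous g -> touch g x 0 C B ->
  (forall a, g (x + a) <= g x) -> below g x 0 p C B m -> m <= 0.
Proof.
move=> cg tg gx H.
have H' : below (cst 0) x 0 p C B m.
  apply: (below_mono hj1 hj2 (x := x) _ _ _ tg H) => //.
    exact: cst_continuous.
  by move=> a /=; rewrite subrr subr_le0.
have t0 : touch (cst 0 : 'rV[R]_N -> R) x 0 C B.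
  by apply: (touch_mono _ tg) => a /=; rewrite subrr subr_le0.
have cN : \- (cst 0 : 'rV[R]_N -> R) = cst 0 by apply/funext => y /=; rewrite oppr0.
have := below_add hj1 hj2 hM hJ1 _ t0 _ H' (_ : below (\- (cst 0)) x (- 0) p C B 0).
rewrite cN oppr0 addr0; apply => //; first exact: cst_continuous.
rewrite /nonlocal_ge add0r EFinD /gap_int1 /gap_int2.
rewrite -(integral_Zmoment hj1 hJ1) -?(integral_cst_mu2 hM); last by case: tg.
rewrite le_eqVlt; apply/orP; left; apply/eqP; congr (_ + _)%E;
  apply: eq_integral => z _; congr EFin; rewrite /gap /= dotvC dotv0r; ring.
Qed.

Lemma psub_cst : parabolic_sub (cst (- perron_bound)).
Proof.
move=> x p C B l tg H.
have [C0 t1 _] := tg.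
have p0 : p = 0.
  apply: (dotv_le_quadratic (C := C)) => // b.
  by have := t1 (- b); rewrite /gap /= !dotvE; lra.
have /andP[+ _] := F_perron_bound x; apply: le_trans.
move: tg H; rewrite p0 oppr0 => tg H; apply: Fmono.
rewrite -oppr_le0; apply: below_cst_le tg _ H => //.
by apply: continuousN_fun; exact: cst_continuous.
Qed.

Definition perron_class v :=
  [/\ continuous v, boundedf v, forall x, v x <= perron_bound & parabolic_sub v].

Definition perron_sol x := sup [set v x | v in perron_class].

Lemma perron_class_cst : perron_class (cst (- perron_bound)).
Proof.
split; [exact: cst_continuous| |move=> _ /=|exact: psub_cst].
  by exists perron_bound => x /=; rewrite normrN ger0_norm ?perron_bound_ge0.
by rewrite ge0_cp ?perron_bound_ge0.
Qed.

Lemma perron_has_sup x : has_sup [set v x | v in perron_class].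
Proof.
split; first by exists (- perron_bound), (cst (- perron_bound)) => //; exact: perron_class_cst.
by exists perron_bound => _ [v [_ _ + _] <-].
Qed.

Lemma perron_sol_ub v x : perron_class v -> v x <= perron_sol x.
Proof. by move=> Sv; apply: (ub_le_sup (proj2 (perron_has_sup x))); exists v. Qed.

Lemma perron_sol_le x c : (forall v, perron_class v -> v x <= c) -> perron_sol x <= c.
Proof. by move=> H; apply: (ge_sup (proj1 (perron_has_sup x))) => _ [v Sv <-]; exact: H. Qed.

Lemma perron_sol_adherent x e : 0 < e ->
  exists2 v, perron_class v & perron_sol x - e < v x.
Proof.
by move=> e0; have [_ [v Sv <-] H] := sup_adherent e0 (perron_has_sup x); exists v.
Qed.

Lemma perron_class_translate v h e : 0 <= e ->
  (forall x, f (x + h) <= f x + gamma * e) ->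
  perron_class v -> perron_class (fun x => v (x + h) - e).
Proof.
move=> e0 fe [cv [M bv] vK sv].
have cvh : continuous (fun x => v (x + h) - e).
  move=> x; apply: (@cvgB _ _ _ (nbhs x)); last exact: cvg_cst.
  by apply: (@continuous_comp _ _ _ (fun y => y + h) v); [exact: continuous_addr|exact: cv].
split => //.
- exists (M + e) => x; rewrite (le_trans (ler_normB _ _))// lerD ?(ger0_norm e0)//.
- by move=> x; have := vK (x + h); lra.
move=> x p C B l tg H.
have eqv a : - (v (x + a + h) - e) + (v (x + h) - e) = - v (x + h + a) + v (x + h).
  by rewrite addrAC; ring.
have tg' : touch (\- v) (x + h) (- p) C B.
  by apply: touch_mono tg => a /=; rewrite !opprK eqv.
have H' : below (\- v) (x + h) (- p) p C B (- l).
  apply: (below_mono hj1 hj2 _ _ _ tg H); [exact: continuousN_fun|exact: continuousN_fun|].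
  by move=> a /=; rewrite !opprK eqv.
have := sv _ _ _ _ _ tg' H'; have := fe x.
have : v (x + h) - e <= v (x + h) by lra.
(* Lowering the value by [e] lowers [F] by at least [gamma * e], which pays for replacing
   [f (x + h)] by [f x]. *)
by move=> /(Fgamma p l); rewrite opprB addrC subrK; lra.
Qed.

Lemma perron_sol_translate x h e : 0 <= e ->
  (forall y, f (y + h) <= f y + gamma * e) -> perron_sol (x + h) <= perron_sol x + e.
Proof.
move=> e0 fe; apply: perron_sol_le => v Sv.
by have := perron_sol_ub x (perron_class_translate e0 fe Sv); lra.
Qed.

Lemma perron_sol_unif_cont : unif_cont perron_sol.
Proof.
move=> e e0.
have e1 : 0 < gamma * (e / 2) by rewrite mulr_gt0 ?divr_gt0.
have [d d0 H] := f_uc e1; exists d => // x y xyd.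
have e2 : 0 <= e / 2 by rewrite divr_ge0 ?ltW.
have t a b : enorm (a - b) < d -> perron_sol a <= perron_sol b + e / 2.
  move=> abd; rewrite -[a in leLHS](subrK b) addrC; apply: perron_sol_translate => // z.
  have := H (z + (a - b)) z; rewrite addrAC subrr add0r => /(_ abd).
  by rewrite ltr_norml => /andP[_]; lra.
have t1 := t _ _ xyd.
have t2 : perron_sol y <= perron_sol x + e / 2.
  by apply: t; rewrite -opprB /enorm dotvNl dotvNr opprK.
by rewrite ltr_norml; apply/andP; split; lra.
Qed.

Lemma perron_sol_bound x : - perron_bound <= perron_sol x <= perron_bound.
Proof.
rewrite (perron_sol_ub x perron_class_cst)/=.
by apply: perron_sol_le => v [].
Qed.

Lemma perron_sol_continuous : continuous perron_sol.
Proof. exact: unif_cont_continuous perron_sol_unif_cont. Qed.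

Lemma cvg_sqr_dist (xn : nat -> 'rV[R]_N) x c :
  (forall k, dotv (xn k - x) (xn k - x) <= c * k.+1%:R^-1) -> xn @ \oo --> x.
Proof.
move=> H; apply: cvg_enormP => e e0.
have e2 : 0 < e ^+ 2 by rewrite exprn_gt0.
have := @cvgr_lt _ _ _ eventually_filter _ _ (@cvg_inv_nat c) _ e2.
apply: filterS => k Hk; rewrite -(ltr_pXn2r (n := 2))// ?nnegrE ?enorm_ge0 ?ltW//.
by rewrite sqr_enorm; exact: le_lt_trans (H k) Hk.
Qed.

(** Take members [v k] of the class, nearly optimal at [x], and slide the test paraboloid onto them.
    Curvature [C + 1] instead of [C] makes the contact strict, so the contact points satisfy
    [|xn k - x|^2 <= 1 / (k + 1)], and stability carries the inequality to the supremum. *)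
Lemma perron_sol_psub : parabolic_sub perron_sol.
Proof.
move=> x p C B l tg H; have [C0 t1 t2] := tg.
pose inv k : R := k.+1%:R^-1.
have inv0 k : 0 < inv k by rewrite invr_gt0.
have inv1 k : inv k <= 1 by rewrite invf_le1// ler1n.
have /choice[v Hv] : forall k, exists v, perron_class v /\ perron_sol x - inv k < v x.
  by move=> k; have [v Sv Hv] := perron_sol_adherent x (inv0 k); exists v.
have cv k : continuous (v k) by have [[]] := Hv k.
have C1 : 0 < C + 1 by rewrite ltr_wpDl.
have /choice[xn Hxn] : forall k, exists y, forall z,
    - v k y + dotv p (y - x) + (C + 1) * dotv (y - x) (y - x) <=
    - v k z + dotv p (z - x) + (C + 1) * dotv (z - x) (z - x).
  move=> k; apply: (@parabola_minimizer _ _ (\- v k) x p (C + 1) (- perron_bound)) => //.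
    exact: continuousN_fun.
  by move=> y; have [[_ _ vK _] _] := Hv k; rewrite /= lerN2.
have [d dE] : exists d, forall k, xn k - x = d k by exists (fun k => xn k - x).
have dle k : dotv (d k) (d k) <= 1 * inv k.
  have := Hxn k x; rewrite subrr !dotv0r mulr0 !addr0 dE.
  have := t1 (d k); rewrite /gap -[x + _](_ : xn k = _) ?dotvNl /=; last by rewrite -dE addrC subrK.
  have [Sv] := Hv k; have := perron_sol_ub (xn k) Sv; lra.
have cx : xn @ \oo --> x by apply: (@cvg_sqr_dist _ _ 1) => k; rewrite dE; exact: dle.
have cd : d @ \oo --> (0 : 'rV[R]_N).
  rewrite (_ : d = fun k => xn k - x); last by apply/funext => k; rewrite dE.
  by rewrite -(subrr x); apply: cvgB => //; exact: cvg_cst.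
(* Gradient at [xn k] of the paraboloid touching [v k] from above. *)
pose pn k := p + (2 * (C + 1)) *: d k.
have cp : pn @ \oo --> p.
  rewrite -[X in _ --> X]addr0 -(scaler0 _ (2 * (C + 1))).
  by apply: cvgD; [exact: cvg_cst|apply: cvgZ; [exact: cvg_cst|exact: cd]].
(* A squeeze: [v k] lies below the continuous [perron_sol], and minimality of [xn k], tested at [x],
   bounds [v k (xn k)] from below by [v k x] up to vanishing terms. *)
have cvx : - v k (xn k) @[k --> \oo] --> - perron_sol x.
  have low : - perron_sol (xn k) @[k --> \oo] --> - perron_sol x.
    apply: cvgN.
    exact: (@cvg_comp _ _ _ xn _ _ (nbhs x) _ cx (@perron_sol_continuous x)).
  have up : - perron_sol x + 1 * inv k - dotv p (d k) - (C + 1) * dotv (d k) (d k) @[k --> \oo]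
      --> - perron_sol x + 0 - dotv p 0 - (C + 1) * dotv (0 : 'rV[R]_N) 0.
    apply: cvgB; last by apply: cvgM; [exact: cvg_cst|exact: cvg_dotv].
    apply: cvgB; last by apply: cvg_dotv => //; exact: cvg_cst.
    by apply: cvgD; [exact: cvg_cst|exact: cvg_inv_nat].
  rewrite !dotv0r mulr0 !subr0 addr0 in up.
  apply: squeeze_cvgr low up; near=> k; apply/andP; split.
    by rewrite lerN2; apply: perron_sol_ub; have [] := Hv k.
  have := Hxn k x; rewrite subrr !dotv0r mulr0 !addr0 dE.
  by have [_] := Hv k; lra.
(* A drop bound valid for all [k]: the class stays below [perron_bound], and minimality tested at
   [x], with [|d k| <= 1], bounds [v k (xn k)] from below. *)
pose B' := B + (perron_bound - perron_sol x + 2 + dotv p p).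
have BB : B <= B'.
  by have /andP[_] := perron_sol_bound x; have := dotv_ge0 p; rewrite /B'; lra.
have CC : C <= C + 1 by lra.
have H' := below_weaken hj1 hj2 hM hJ1 (continuousN_fun perron_sol_continuous) CC BB tg H.
have tg' := touch_weaken CC BB tg.
have tn k : touch (\- v k) (xn k) (- pn k) (C + 1) B'.
  split => [|a|a]; first exact: ltW.
    have := Hxn k (xn k + a); rewrite /gap /pn /=.
    have -> : xn k + a - x = d k + a by rewrite addrAC dE.
    by rewrite dE !dotvE (dotvC a (d k)); lra.
  rewrite gap_osc /=.
  have [[_ _ vK _] vx] := Hv k.
  have := Hxn k x; rewrite subrr !dotv0r mulr0 !addr0 dE.
  have := dotv2_le (- p) (d k); rewrite dotvNl dotvNr dotvNl opprK.
  have := dle k; have := inv1 k; have := vK (xn k + a); have := dotv_ge0 (d k).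
  have := mulr_ge0 C0 (dotv_ge0 (d k)); have := dotv_ge0 p; have := touch_B_ge0 tg.
  rewrite /B'; nra.
apply: F_right_le => e e0.
have cNp : (fun k => - pn k) @ \oo --> - p by apply: cvgN.
have cv' : v k (xn k) @[k --> \oo] --> perron_sol x.
  by rewrite -[perron_sol x]opprK; under eq_fun do rewrite -[v _ _]opprK; exact: cvgN.
have UNv k y : - perron_sol y <= - v k y.
  by rewrite lerN2; apply: perron_sol_ub; have [] := Hv k.
apply: (ler_cvg_to (cvg_F cv' cp (@cvg_cst _ (l + e) _ \oo _)) (cvg_f cx)).
have st := below_stable hj1 hj2 hJ1 hJ2 (gn := fun k => \- v k) (fun k => continuousN_fun (cv k))
  (continuousN_fun perron_sol_continuous) cx cNp cp tn tg' UNv cvx H' e0.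
apply: filterS st => k Hk.
have [[_ _ _ sv] _] := Hv k; apply: sv (tn k) _.
by rewrite (_ : - (l + e) = - l - e)//; exact: opprD.
Unshelve. all: by end_near. Qed.

(** The raised function [w k] exceeds the supremum at [x], so it must violate the subsolution
    inequality somewhere. There it is touched by paraboloids from both sides: [below_add] caps every
    level [m], and the violation becomes the supersolution inequality for [w k]. Letting [s k] tend
    to 0, stability returns it to [perron_sol]. *)
Lemma perron_sol_psuper : parabolic_super perron_sol.
Proof.
move=> x p C B l tg H; have [C0 t1 t2] := tg.
have B0 := touch_B_ge0 tg.
have cU := perron_sol_continuous.
have /andP[Ulo Uhi] := perron_sol_bound x.
(* At the ceiling no bump is admissible; there [x] is a global maximum, so [p = 0], the operator is
   nonpositive and the upper barrier gives the inequality. *)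
have [UK|KU] := ltP (perron_sol x) perron_bound; last first.
  have UxK : perron_sol x = perron_bound by apply: le_anti; rewrite Uhi.
  have Ule a : perron_sol (x + a) <= perron_sol x.
    by rewrite UxK; have /andP[] := perron_sol_bound (x + a).
  have p0 : p = 0.
    apply: (dotv_le_quadratic (C := C)) => // b.
    by have := t1 b; have := Ule b; rewrite /gap; lra.
  move: tg H; rewrite p0 => tg H.
  have l0 := below_cst_le cU tg Ule H.
  have /andP[_ fK] := F_perron_bound x; rewrite UxK.
  exact: le_trans fK (Fmono _ _ l0).
have C1 : 0 < C + 1 by rewrite ltr_wpDl.
have cpx : continuous (fun y => perron_sol x + dotv p (y - x)).
  move=> y; apply: (@cvgD _ _ _ (nbhs y)); first exact: cvg_cst.
  by apply: (@cvg_dotv _ _ _ (nbhs y)); [exact: cvg_cst|exact: continuous_addr].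
(* The bump must stay below [perron_bound]: within [d0] the affine part uses less than half of the
   room at [x], the height [c] at most the other half, and [c <= d0 ^+ 2] confines the bump to that
   ball. *)
have [d0 d00 Hd0] : exists2 d, 0 < d & forall y, enorm (y - x) < d ->
    perron_sol x + dotv p (y - x) < (perron_sol x + perron_bound) / 2.
  apply: near_enorm_ball; apply: (@cvgr_lt _ _ _ (nbhs_filter x) _ _ (@cpx x)).
  by rewrite subrr dotv0r; lra.
pose c := Num.min (d0 ^+ 2) ((perron_bound - perron_sol x) / 2).
have c0 : 0 < c by rewrite lt_min exprn_gt0//= divr_gt0// subr_gt0.
pose s k : R := c * k.+1%:R^-1.
have s0 k : 0 < s k by rewrite mulr_gt0// invr_gt0.
have sc k : s k <= c by rewrite ler_piMr ?(ltW c0)// invf_le1// ler1n.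
(* Curvature [C + 1] keeps [Q] below [perron_sol] by [|y - x|^2], so [Q + s k] exceeds it only where
   [|y - x|^2 < s k]. *)
pose Q y := perron_sol x + dotv p (y - x) - (C + 1) * dotv (y - x) (y - x).
have QU y : Q y <= perron_sol y - dotv (y - x) (y - x).
  by have := t1 (y - x); rewrite /gap (addrC x) subrK /Q; lra.
have QD y a : Q (y + a) = Q y + dotv (p - (2 * (C + 1)) *: (y - x)) a - (C + 1) * dotv a a.
  have -> : Q (y + a) = perron_sol x + dotv p (y - x + a) - (C + 1) * dotv (y - x + a) (y - x + a).
    by rewrite /Q (_ : y + a - x = y - x + a)//; exact: addrAC.
  by rewrite /Q; move: (y - x) => d; rewrite !dotvE (dotvC a d); ring.
have cQ : continuous Q.
  move=> y; apply: (@cvgB _ _ _ (nbhs y)); first exact: cpx.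
  apply: (@cvgM _ _ (nbhs y)); first exact: cvg_cst.
  by apply: (@cvg_dotv _ _ _ (nbhs y)); exact: continuous_addr.
pose w k y := Num.max (perron_sol y) (Q y + s k).
have wU k y : perron_sol y <= w k y by rewrite le_max lexx.
have wQ k y : Q y + s k <= w k y by rewrite le_max lexx orbT.
have cw k : continuous (w k).
  apply: (@max_fun_continuous _ _ _ perron_sol (fun y => Q y + s k)) => // y.
  by apply: (@cvgD _ _ _ (nbhs y)); [exact: cQ|exact: cvg_cst].
have wK k y : w k y <= perron_bound.
  rewrite ge_max; have /andP[_ ->] /= := perron_sol_bound y.
  have [le1|lt1] := leP (dotv (y - x) (y - x)) (s k); last first.
    by have /andP[_] := perron_sol_bound y; have := QU y; lra.
  have [yd|dy] := ltP (enorm (y - x)) d0; last first.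
    have : d0 ^+ 2 <= dotv (y - x) (y - x).
      by rewrite -sqr_enorm ler_pXn2r// nnegrE ?enorm_ge0// ltW.
    have /andP[_] := perron_sol_bound y; have := QU y.
    have : c <= d0 ^+ 2 by rewrite ge_min lexx.
    by have := sc k; lra.
  have := Hd0 y yd; have : c <= (perron_bound - perron_sol x) / 2 by rewrite ge_min lexx orbT.
  have := mulr_ge0 (ltW C1) (dotv_ge0 (y - x)); have := sc k; rewrite /Q; lra.
have wlo k y : - perron_bound <= w k y.
  by apply: le_trans (wU k y); have /andP[] := perron_sol_bound y.
pose B' := B + 2 * perron_bound.
have BB : B <= B' by rewrite lerDl mulr_ge0// perron_bound_ge0.
have CC : C <= C + 1 by rewrite lerDl.
pose qq y := p - (2 * (C + 1)) *: (y - x).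
have /choice[xn Hxn] : forall k, exists y, [/\ touch (w k) y (qq y) (C + 1) B',
    w k y = Q y + s k, dotv (y - x) (y - x) <= s k &
    forall m, below (w k) y (qq y) (qq y) (C + 1) B' m -> f y <= F (w k y) (qq y) m].
  move=> k.
  have : ~ parabolic_sub (w k).
    move=> sw; have Sw : perron_class (w k).
      split => //; exists perron_bound => y.
      by rewrite ler_norml wlo wK.
    have := perron_sol_ub x Sw; have := wQ k x; rewrite /Q subrr !dotv0r mulr0.
    have := s0 k; lra.
  move=> nsw; apply: contrapT => nH; apply: nsw => y q Cy By ly ty Hy.
  (* Where [w k] agrees with [perron_sol], whatever touches [w k] from above also touches
     [perron_sol], already known to be a subsolution. *)
  have [wE|wN] := eqVneq (w k y) (perron_sol y).
    have UU a : - w k (y + a) - - w k y <= - perron_sol (y + a) - - perron_sol y.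
      by rewrite wE lerD2r lerN2.
    rewrite wE; apply: (perron_sol_psub (touch_mono UU ty)).
    by apply: (below_mono hj1 hj2 _ _ UU ty Hy); exact: continuousN_fun.
  rewrite leNgt; apply/negP => Fy; apply: nH; exists y.
  have wE : w k y = Q y + s k.
    by move: wN; rewrite /w; case: leP => // _; rewrite eqxx.
  have [Cy0 ty1 ty2] := ty.
  (* The test paraboloid touches [w k] from above and [Q + s k] touches it from below, so their
     gradients agree. *)
  have qE : qq y = q.
    apply/eqP; rewrite -subr_eq0; apply/eqP.
    apply: (dotv_le_quadratic (C := Cy + (C + 1))); first by rewrite addr_ge0// ltW.
    move=> a; have := ty1 a; have := wQ k (y + a); rewrite /gap /= wE QD -/(qq y).
    by rewrite (dotvDl (qq y) (- q) a) !dotvNl; lra.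
  have twy : touch (w k) y (qq y) (C + 1) B'.
    split => [|a|a]; first exact: ltW.
      by have := wQ k (y + a); rewrite /gap wE QD -/(qq y); lra.
    by rewrite gap_osc; have := wlo k (y + a); have := wK k y; rewrite /B'; lra.
  split => //.
    have := QU y; have : perron_sol y <= Q y + s k by rewrite -wE.
    lra.
  move=> m Hm; apply: (le_trans (ltW Fy)); rewrite -qE; apply: Fmono.
  rewrite -qE in ty Hy.
  by have := below_add hj1 hj2 hM hJ1 (cw k) twy ty Hm Hy; lra.
have xs k : dotv (xn k - x) (xn k - x) <= s k by have [] := Hxn k.
have cx : xn @ \oo --> x by exact: cvg_sqr_dist xs.
have cq : (fun k => qq (xn k)) @ \oo --> p.
  rewrite -[X in _ --> X]subr0 -(scaler0 _ (2 * (C + 1))) -(subrr x).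
  by apply: cvgB; [exact: cvg_cst|apply: cvgZ; [exact: cvg_cst|apply: cvgB => //; exact: cvg_cst]].
have cwx : w k (xn k) @[k --> \oo] --> perron_sol x.
  have -> : (fun k => w k (xn k)) = (fun k => Q (xn k) + s k).
    by apply/funext => k; have [] := Hxn k.
  rewrite -[X in _ --> X]addr0; apply: cvgD; last exact: cvg_inv_nat.
  have <- : Q x = perron_sol x by rewrite /Q subrr !dotv0r mulr0 subr0 addr0.
  exact: (@cvg_comp _ _ _ xn _ _ (nbhs x) _ cx (@cQ x)).
apply: F_left_ge => e e0.
have tw k : touch (w k) (xn k) (qq (xn k)) (C + 1) B' by have [] := Hxn k.
apply: (ler_cvg_to (cvg_f cx) (cvg_F cwx cq (@cvg_cst _ (l - e) _ \oo _))).
have H' := below_weaken hj1 hj2 hM hJ1 cU CC BB tg H.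
have st := below_stable hj1 hj2 hJ1 hJ2 cw cU cx cq cq tw (touch_weaken CC BB tg) wU cwx H' e0.
by apply: filterS st => k Hk; have [_ _ _] := Hxn k; exact.
Qed.

End Perron.

(** * The bounded penalty and extraction of convergent slopes *)

Section Penalty.
Variables (R : realType) (N : nat).
Implicit Types (x y p a : 'rV[R]_N) (t : R).

(** With a large factor it dominates bounded functions at infinity, yet its gradient and its upper
    second-order bound tend to 0 with [t], uniformly in [x]. *)
Definition psi t x : R := 1 - (1 + t * dotv x x)^-1.
Definition dpsi t x : 'rV[R]_N := (2 * t / (1 + t * dotv x x) ^+ 2) *: x.

Lemma psi_den_ge1 t x : 0 <= t -> 1 <= 1 + t * dotv x x.
Proof. by move=> t0; rewrite lerDl mulr_ge0// dotv_ge0. Qed.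

Lemma psi_ge0 t x : 0 <= t -> 0 <= psi t x.
Proof.
by move=> t0; rewrite subr_ge0 invf_le1 ?psi_den_ge1// (lt_le_trans ltr01)// psi_den_ge1.
Qed.

Lemma psi_le t x : 0 <= t -> psi t x <= t * dotv x x.
Proof.
move=> t0; have q1 := psi_den_ge1 x t0; rewrite /psi.
move: q1; set s := t * dotv x x => q1; have s0 : 0 <= s by rewrite mulr_ge0// dotv_ge0.
have q0 : 0 < 1 + s by lra.
rewrite -(ler_pM2r q0) mulrBl mulVf ?gt_eqF//; nra.
Qed.

Lemma psi_half t x : 0 <= t -> 1 <= t * dotv x x -> 1 / 2 <= psi t x.
Proof.
rewrite /psi => t0; set s := t * dotv x x => s1.
have q0 : 0 < 1 + s by lra.
by rewrite -(ler_pM2r q0) mulrBl mulVf ?gt_eqF//; lra.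
Qed.

(** With [q], [q'] the values of [1 + t|.|^2] at [x] and [x + a], the remainder is exactly
    [t|a|^2 / q^2 - (q' - q)^2 / (q^2 q')]; the square has the right sign and [q >= 1]. *)
Lemma psi_taylor t x a : 0 <= t ->
  psi t (x + a) - psi t x <= dotv (dpsi t x) a + t * dotv a a.
Proof.
move=> t0; rewrite /psi /dpsi dotvZl.
have q1 := psi_den_ge1 x t0; have q1' := psi_den_ge1 (x + a) t0.
have D0 := dotv_ge0 a.
have e : 1 + t * dotv (x + a) (x + a) = 1 + t * dotv x x + (2 * t * dotv x a + t * dotv a a).
  by rewrite !dotvE (dotvC a x); ring.
move: e q1 q1'; set q := 1 + t * dotv x x; set q' := 1 + t * _.
set s := dotv x a; set A := dotv a a => e q1 q1'.
have q0 : 0 < q by lra.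
have q0' : 0 < q' by lra.
have -> : 1 - q'^-1 - (1 - q^-1) = 2 * t / q ^+ 2 * s + t * A / q ^+ 2 - (q' - q) ^+ 2 / (q ^+ 2 * q').
  have -> : t * A = q' - q - 2 * t * s by lra.
  by field; rewrite !gt_eqF.
have : 0 <= (q' - q) ^+ 2 / (q ^+ 2 * q') by rewrite divr_ge0 ?sqr_ge0// mulr_ge0 ?sqr_ge0// ltW.
have : t * A / q ^+ 2 <= t * A.
  by rewrite ler_pdivrMr ?exprn_gt0// ler_peMr ?mulr_ge0// exprn_ege1.
lra.
Qed.

Lemma dpsi_le t x : 0 <= t -> dotv (dpsi t x) (dpsi t x) <= 4 * t.
Proof.
move=> t0; rewrite /dpsi dotvZl dotvZr; have q1 := psi_den_ge1 x t0.
move: q1; set q := 1 + t * dotv x x => q1; have q0 : 0 < q by lra.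
have -> : 2 * t / q ^+ 2 * (2 * t / q ^+ 2 * dotv x x) = 4 * t * ((q - 1) / q ^+ 4).
  by rewrite /q; field; rewrite gt_eqF.
rewrite ler_piMr ?mulr_ge0// ler_pdivrMr ?exprn_gt0// mul1r.
by have := exprn_ege1 3 q1; rewrite [q ^+ 4]exprS; nra.
Qed.

Lemma psi_continuous t : 0 <= t -> continuous (psi t).
Proof.
move=> t0 x; apply: (@cvgB _ _ _ (nbhs x)); first exact: cvg_cst.
have q1 := psi_den_ge1 x t0.
apply: (@cvgV _ _ (nbhs x)); first by rewrite gt_eqF// (lt_le_trans ltr01).
apply: (@cvgD _ _ _ (nbhs x)); first exact: cvg_cst.
by apply: (@cvgM _ _ (nbhs x)); [exact: cvg_cst|exact: continuous_sqnorm].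
Qed.

(** [s] need not be increasing: [k <= s k] is enough to keep a decreasing null sequence small along
    it. *)
Lemma bounded_subsequence (p : nat -> 'rV[R]_N) r : (forall k, dotv (p k) (p k) <= r) ->
  exists p0 (s : nat -> nat), (forall k, (k <= s k)%N) /\ p \o s @ \oo --> p0.
Proof.
move=> pr.
have [|p0 [_ clp]] := @compact_sublevel R N r 0 (p @ \oo) _.
  by exists 0%N => // k _ /=; rewrite subr0; exact: pr.
have /choice[s Hs] : forall k, exists j, (k <= j)%N /\ enorm (p j - p0) < k.+1%:R^-1.
  move=> k; have k0 : (0 : R) < k.+1%:R^-1 by rewrite invr_gt0.
  have [|_ [[j /= kj <-] Bj]] := clp [set p j | j in [set j | (k <= j)%N]]
      [set q | enorm (q - p0) < k.+1%:R^-1] _ (near_enorm p0 k0).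
  by exists k => // j kj; exists j.
 by exists j.
exists p0, s; split => [k|]; first by have [] := Hs k.
apply: cvg_enormP => e e0.
have := @cvgr_lt _ _ _ eventually_filter _ _ (@cvg_inv_nat R 1) _ e0.
apply: filterS => k; rewrite mul1r => /(lt_trans _); apply.
by have [] := Hs k.
Qed.

End Penalty.

(** * Doubling of variables *)

Section Doubling.
Variables (R : realType) (N : nat).
Implicit Types (u v : 'rV[R]_N -> R) (x y p a b : 'rV[R]_N) (t k S M : R).

(** Outside a compact set the functional is at most 0, while it is at least 0 at [(x0, x0)]: for
    [t|x|^2 > 1] the penalty is at least [S / 2 >= 2 M], and otherwise a large [y] makes
    [k|x - y|^2 >= 2 M]. *)
Lemma doubling_max u v x0 M k S t : continuous u -> continuous v ->
  (forall x, `|u x| <= M) -> (forall x, `|v x| <= M) ->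
  0 < k -> 0 < t -> 4 * M <= S -> t * dotv x0 x0 <= 1 -> 0 <= u x0 - v x0 - S * psi t x0 ->
  exists z : 'rV[R]_N * 'rV[R]_N, forall x y,
    u x - v y - k * dotv (x - y) (x - y) - S * psi t x <=
    u z.1 - v z.2 - k * dotv (z.1 - z.2) (z.1 - z.2) - S * psi t z.1.
Proof.
move=> cu cv uM vM k0 t0 MS tx0 u0.
have M0 : 0 <= M by exact: le_trans (uM x0).
have S0 : 0 <= S by apply: le_trans MS; rewrite mulr_ge0.
(* From [|y|^2 <= 2|y - x|^2 + 2|x|^2]: if [|x|^2 <= 1/t] and [|y|^2 > r], then
   [|x - y|^2 >= 2 M / k]. *)
pose r := 2 * t^-1 + 2 * (2 * M / k).
have r0 : 0 <= 2 * (2 * M / k) by rewrite !mulr_ge0// invr_ge0 ltW.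
have ti0 : 0 < t^-1 by rewrite invr_gt0.
pose h (z : 'rV[R]_N * 'rV[R]_N) :=
  - (u z.1 - v z.2 - k * dotv (z.1 - z.2) (z.1 - z.2) - S * psi t z.1).
have cf1 (w : 'rV[R]_N -> R) : continuous w -> continuous (fun z : 'rV[R]_N * 'rV[R]_N => w z.1).
  by move=> cw z; apply: (@continuous_comp _ _ _ fst w); [exact: cvg_fst|exact: cw].
have cf2 (w : 'rV[R]_N -> R) : continuous w -> continuous (fun z : 'rV[R]_N * 'rV[R]_N => w z.2).
  by move=> cw z; apply: (@continuous_comp _ _ _ snd w); [exact: cvg_snd|exact: cw].
have ch : continuous h.
  have cd : continuous (fun z : 'rV[R]_N * 'rV[R]_N => z.1 - z.2).
    move=> z; apply: (@cvgB _ _ _ (nbhs z) _ fst snd); [exact: cvg_fst|exact: cvg_snd].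
  move=> z; apply: (@cvgN _ _ _ (nbhs z)).
  apply: (@cvgB _ _ _ (nbhs z)); last first.
    apply: (@cvgM _ _ (nbhs z)); first exact: cvg_cst.
    by apply: (cf1 (psi t)); apply: psi_continuous; exact: ltW.
  apply: (@cvgB _ _ _ (nbhs z)); last first.
    apply: (@cvgM _ _ (nbhs z)); first exact: cvg_cst.
    by apply: (@cvg_dotv _ _ _ (nbhs z)); exact: cd.
  by apply: (@cvgB _ _ _ (nbhs z)); [exact: cf1|exact: cf2].
pose K := [set x : 'rV[R]_N | dotv (x - 0) (x - 0) <= t^-1] `*`
          [set y : 'rV[R]_N | dotv (y - 0) (y - 0) <= r].
have x0t : dotv x0 x0 <= t^-1 by rewrite -[t^-1]mul1r ler_pdivlMr// mulrC.
have [|||z Hz] := @exists_minimizer R _ h K (x0, x0) _ ch _ _.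
- by apply: compact_setX; exact: compact_sublevel.
- by split; rewrite /= subr0// (le_trans x0t)// /r; lra.
- move=> [x y] nK; rewrite /h /= lerN2 subrr dotv0r mulr0 subr0.
  apply: le_trans u0.
  have := uM x; rewrite ler_norml => /andP[_ ux]; have := vM y; rewrite ler_norml => /andP[vy _].
  have d0 := dotv_ge0 (x - y); have p0 := psi_ge0 x (ltW t0).
  have kd0 := mulr_ge0 (ltW k0) d0; have Sp0 := mulr_ge0 S0 p0.
  have [xt|xt] := leP (dotv x x) t^-1; last first.
    have : 1 / 2 <= psi t x.
      apply: psi_half; first exact: ltW.
      by have := ler_wpM2l (ltW t0) (ltW xt); rewrite divff ?gt_eqF.
    move=> /(ler_wpM2l S0); lra.
  have yr : r < dotv y y by rewrite ltNge; apply/negP => yr; apply: nK; split; rewrite /= subr0.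
  have := dotv_add_le (y - x) x; rewrite subrK => yx.
  have : 2 * M / k <= dotv (x - y) (x - y).
    by rewrite -[x - y]opprB dotvNl dotvNr opprK; move: yr; rewrite /r; lra.
  rewrite ler_pdivrMr// mulrC; lra.
by exists z => x y; have := Hz (x, y); rewrite /h /= lerN2.
Qed.

(** The shifts [a] and [b] are independent because the two jumps are taken at different slopes;
    [k|a - b|^2] is the price of their difference. [b = 0] and [a = 0] yield the paraboloids
    touching [u] and [v]. *)
Lemma doubling_ineq u v x y k S t : 0 <= t -> 0 <= S ->
  (forall x' y', u x' - v y' - k * dotv (x' - y') (x' - y') - S * psi t x' <=
    u x - v y - k * dotv (x - y) (x - y) - S * psi t x) ->
  forall a b,
    (u (x + a) - u x - dotv ((2 * k) *: (x - y) + S *: dpsi t x) a) -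
    (v (y + b) - v y - dotv ((2 * k) *: (x - y)) b) <=
    k * dotv (a - b) (a - b) + S * t * dotv a a.
Proof.
move=> t0 S0 H a b; have := H (x + a) (y + b).
have -> : x + a - (y + b) = (x - y) + (a - b) by rewrite opprD addrACA.
have := ler_wpM2l S0 (psi_taylor x a t0).
move: (x - y) (dpsi t x) => d e; rewrite !dotvE (dotvC a d) (dotvC b d) (dotvC b a).
lra.
Qed.

End Doubling.

(** * Comparison of parabolic sub- and supersolutions *)

Section Comparison.
Variables (R : realType) (N P : nat).
Variables (mu1 mu2 : {measure set (borelRV R P) -> \bar R}).
Variables (j1 j2 : 'rV[R]_N -> 'rV[R]_P -> 'rV[R]_N).
Variables (F : R -> 'rV[R]_N -> R -> R) (f : 'rV[R]_N -> R).
Implicit Types (g u v : 'rV[R]_N -> R) (x y q p a b : 'rV[R]_N) (B C m l e t : R).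

Notation below := (nonlocal_ge mu1 mu2 j1 j2).
Notation int1 := (gap_int1 mu1 j1).
Notation int2 := (gap_int2 mu2 j2).
Notation J := (jump_moment mu1 j1).
Notation m2 := (mass2 mu2).

Hypothesis hj1 : borel_measurable (fun pz : 'rV[R]_N * 'rV[R]_P => j1 pz.1 pz.2).
Hypothesis hj2 : borel_measurable (fun pz : 'rV[R]_N * 'rV[R]_P => j2 pz.1 pz.2).
Hypothesis hM : hypM mu1 mu2.
Hypothesis hJ1 : hypJ1 mu1 mu2 j1 j2.
Hypothesis hJ2 : hypJ2 mu1 j1.

(** The doubling inequality integrated with [a = j1 p z], [b = j1 p' z]. Written with sums of
    nonnegative gaps it makes sense even where the operators are infinite, and the errors are those
    controlled by (J2) and the second moment. *)
Lemma int1_compare g g' x x' q q' p p' C k e : continuous g -> continuous g' ->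
  0 <= C -> 0 <= k -> 0 <= e ->
  (forall a, 0 <= gap C 0 g x q a) -> (forall a, 0 <= gap C 0 g' x' q' a) ->
  (forall a b, C * dotv a a + C * dotv b b <=
     gap C 0 g x q a + gap C 0 g' x' q' b + k * dotv (a - b) (a - b) + e * dotv a a) ->
  ((C * J p + C * J p')%:E <=
    int1 g x q p C + int1 g' x' q' p' C
    + (k%:E * \int[mu1]_(z in @punct R P) (dotv (j1 p z - j1 p' z) (j1 p z - j1 p' z))%:E
    + (e * J p)%:E))%E.
Proof.
move=> cg cg' C0 k0 e0 g0 g0' H.
have mP := @measurable_punct R P.
have CJ := integral_Zmoment hj1 hJ1.
rewrite EFinD -!CJ// -ge0_integralZl_EFin//; last 2 first.
- by move=> z _; rewrite lee_fin dotv_ge0.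
- by apply/measurable_EFinP; exact: measurable_sqjumpB.
have mg1 := measurable_gap1 hj1.
have msq (c : R) p0 : measurable_fun (@punct R P)
    (fun z : borelRV R P => (c * dotv (j1 p0 z) (j1 p0 z))%:E).
  by apply/measurable_EFinP; apply: measurable_funM => //; exact: measurable_sqjump.
have mB : measurable_fun (@punct R P)
    (fun z : borelRV R P => k%:E * (dotv (j1 p z - j1 p' z) (j1 p z - j1 p' z))%:E)%E.
  by apply/measurable_EFinP; apply: measurable_funM => //; exact: measurable_sqjumpB.
have pos (c : R) a : 0 <= c -> (0 <= (c * dotv a a)%:E)%E.
  by move=> c0; rewrite lee_fin mulr_ge0// dotv_ge0.
rewrite -!ge0_integralD//; try by
  [ move=> z _; apply: pos | move=> z _; rewrite lee_fin
  | apply/measurable_EFinP; exact: mg1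
  | move=> z _; apply: adde_ge0; rewrite ?pos// lee_fin
  | exact: emeasurable_funD
  | apply: emeasurable_funD => //; apply/measurable_EFinP; exact: mg1].
apply: ge0_le_integral => //.
- by move=> z _; apply: adde_ge0; apply: pos.
- exact: emeasurable_funD.
- by apply: emeasurable_funD; apply: emeasurable_funD => //; apply/measurable_EFinP; exact: mg1.
- by move=> z _; rewrite -EFinM -!EFinD lee_fin addrA.
Qed.

(** The jumps [j2] are continuous in [p] for almost every [z], so the slopes are compared pointwise
    in [z] and Fatou's lemma is applied with the constant [2 B] as lower limit. The points [xn],
    [yn] may escape to infinity. *)
Lemma int2_compare u v (xn yn pn pn' : nat -> 'rV[R]_N) p (en : nat -> R) B k e :
  continuous u -> continuous v ->
  pn @ \oo --> p -> pn' @ \oo --> p -> en @ \oo --> (0 : R) ->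
  (forall i a, 0 <= gap 0 B (\- u) (xn i) 0 a) -> (forall i a, 0 <= gap 0 B v (yn i) 0 a) ->
  (forall i a b, (u (xn i + a) - u (xn i) - dotv (pn' i) a) -
     (v (yn i + b) - v (yn i) - dotv (pn i) b) <= k * dotv (a - b) (a - b) + en i * dotv a a) ->
  0 < e ->
  \forall i \near \oo, ((2 * B * m2 - e)%:E <=
    int2 (\- u)%R (xn i) (pn' i) B + int2 v (yn i) (pn i) B)%E.
Proof.
move=> cu cv cp cp' ce gu gv H e0.
have mP := @measurable_punct R P.
have B0 : 0 <= B by have := gv 0%N 0; rewrite gap_osc addr0 subrr addr0.
pose h i (z : borelRV R P) := gap 0 B (\- u) (xn i) 0 (j2 (pn' i) z) + gap 0 B v (yn i) 0 (j2 (pn i) z).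
have mg i q : measurable_fun (@punct R P) (fun z : borelRV R P => gap 0 B (\- u) (xn i) 0 (j2 q z)).
  by apply: (measurable_gap2 hj2); apply: continuousN_fun.
have mg' i q : measurable_fun (@punct R P) (fun z : borelRV R P => gap 0 B v (yn i) 0 (j2 q z)).
  exact: (measurable_gap2 hj2).
have : \forall i \near \oo, ((2 * B * m2 - e)%:E <= \int[mu2]_(z in @punct R P) (h i z)%:E)%E.
  apply: (fatou_near (f := h) (g := cst (2 * B))) => //.
  - by move=> i; exact: measurable_funD.
  - by move=> i z _; apply: addr_ge0; [exact: gu|exact: gv].
  - by move=> z _ /=; rewrite mulr_ge0.
  - have [_ [+ _]] := hJ1; apply: filterS => z cz _ d d0.
    have cj (rn : nat -> 'rV[R]_N) : rn @ \oo --> p -> j2 (rn i) z @[i --> \oo] --> j2 p z.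
      by move=> cr; exact: (@cvg_comp _ _ _ rn (fun p => j2 p z) _ (nbhs p) _ cr (cz p)).
    (* What the doubling inequality leaves at unequal jumps: the two linear terms no longer cancel,
       but both tend to [p.j2 p z]. *)
    pose E i := dotv (pn' i) (j2 (pn' i) z) - dotv (pn i) (j2 (pn i) z)
      + k * dotv (j2 (pn' i) z - j2 (pn i) z) (j2 (pn' i) z - j2 (pn i) z)
      + en i * dotv (j2 (pn' i) z) (j2 (pn' i) z).
    have cE : E i @[i --> \oo] --> dotv p (j2 p z) - dotv p (j2 p z)
      + k * dotv (j2 p z - j2 p z) (j2 p z - j2 p z) + 0 * dotv (j2 p z) (j2 p z).
      apply: cvgD; last by apply: cvgM => //; apply: cvg_dotv; exact: cj.
      apply: cvgD.
        by apply: cvgB; apply: cvg_dotv => //; exact: cj.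
      apply: cvgM; first exact: cvg_cst.
      by apply: cvg_dotv; apply: cvgB; exact: cj.
    rewrite !subrr dotv0r mulr0 mul0r !addr0 in cE.
    have := @cvgr_lt _ _ _ eventually_filter _ _ cE _ d0.
    apply: filterS => i; rewrite /h !gap_osc /E /=.
    by have := H i (j2 (pn' i) z) (j2 (pn i) z); lra.
  - by rewrite /= (integral_cst_mu2 hM) lte_fin; lra.
apply: filterS => i; rewrite -ge0_integralD//.
- by move=> z _; rewrite lee_fin.
- by apply/measurable_EFinP.
- by move=> z _; rewrite lee_fin.
- by apply/measurable_EFinP.
Qed.

(** Either total [T], [T'] may be infinite, so [l] is a cut rather than a value of the operator: [s]
    is the share of [K1 + K2] charged to [- u], the rest goes to [v]. Keeping [s] between 0 and
    [K1 + K2 + e] keeps [l] in a range where (F3) gives a modulus. *)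
Lemma split_level u v x y p p' C B e : 0 <= e -> parabolic_sub mu1 mu2 j1 j2 F f u -> parabolic_super mu1 mu2 j1 j2 F f v ->
  touch (\- u) x (- p') C B -> touch v y p C B ->
  ((C * J p' + C * J p + 2 * B * m2)%:E <= int1 (\- u)%R x (- p')%R p' C + int1 v y p p C
     + (int2 (\- u)%R x p' B + int2 v y p B) + e%:E)%E ->
  exists l, [/\ - (C * J p + B * m2) - e <= l, l <= C * J p' + B * m2, F (u x) p' l <= f x &
    f y <= F (v y) p (l - e)].
Proof.
move=> e0 su sv tu tv; rewrite addeACA.
pose T := (int1 (\- u)%R x (- p')%R p' C + int2 (\- u)%R x p' B)%E.
pose T' := (int1 v y p p C + int2 v y p B)%E; rewrite -/T -/T' => H.
pose K1 := C * J p' + B * m2; pose K2 := C * J p + B * m2.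
have [C0 tu1 tu2] := tu; have [_ tv1 tv2] := tv; have B0 := touch_B_ge0 tu.
have T0 : (0 <= T)%E by apply: adde_ge0; apply: integral_ge0 => z _; rewrite lee_fin.
have T0' : (0 <= T')%E by apply: adde_ge0; apply: integral_ge0 => z _; rewrite lee_fin.
have K10 : 0 <= K1 by rewrite addr_ge0// mulr_ge0// ?(mass2_ge0 hM) ?(jump_moment_ge0 hJ1).
have K20 : 0 <= K2 by rewrite addr_ge0// mulr_ge0// ?(mass2_ge0 hM) ?(jump_moment_ge0 hJ1).
have {}H : ((K1 + K2)%:E <= T + T' + e%:E)%E by apply: le_trans H; rewrite lee_fin /K1 /K2; lra.
have [s [s0 sK sT sT']] : exists s, [/\ 0 <= s, s <= K1 + K2 + e, (s%:E <= T)%E &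
    ((K1 + K2 - s - e)%:E <= T')%E].
  move: T T' T0 T0' H => [t| |] [t'| |] //=.
  - rewrite !lee_fin => t0 t0' H.
    have [tK|Kt] := leP t (K1 + K2 + e); [exists t|exists (K1 + K2 + e)];
      rewrite !lee_fin; split; lra.
  - rewrite !lee_fin => t0 _ _.
    by exists 0; rewrite !lee_fin ?leey; split => //; lra.
  - move=> _; rewrite !lee_fin => t0' _.
    by exists (K1 + K2 + e); rewrite !lee_fin ?leey; split => //; lra.
  - by move=> _ _ _; exists 0; rewrite !leey; split => //; lra.
exists (K1 - s); rewrite -/K1 -/K2; split; [lra|lra| |].
- apply: (su _ _ _ _ _ tu); rewrite /nonlocal_ge.
  by apply: le_trans sT; rewrite lee_fin /K1; lra.
- apply: (sv _ _ _ _ _ tv); rewrite /nonlocal_ge.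
  by apply: le_trans sT'; rewrite lee_fin /K2; lra.
Qed.

Variable gamma : R.
Hypothesis gamma_gt0 : 0 < gamma.
Hypothesis Fgamma : forall (u v : R) p l, v <= u -> gamma * (u - v) <= F u p l - F v p l.
Hypothesis F3 : hypF3 F.
Hypothesis f_uc : unif_cont f.

(** Subtract the two inequalities of [split_level]: monotonicity gains [gamma * (u x - v y)], and
    the modulus [w] at the value [v y] absorbs the change of slope and the loss [e] in the level. *)
Lemma touching_estimate u v x y p p' C B e M r K (w : R -> R) :
  parabolic_sub mu1 mu2 j1 j2 F f u -> parabolic_super mu1 mu2 j1 j2 F f v ->
  touch (\- u) x (- p') C B -> touch v y p C B -> 0 <= e -> e <= 1 ->
  ((C * J p' + C * J p)%:E <=
     int1 (\- u)%R x (- p')%R p' C + int1 v y p p C + (e / 2)%:E)%E ->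
  ((2 * B * m2 - e / 2)%:E <= int2 (\- u)%R x p' B + int2 v y p B)%E ->
  J p <= K -> J p' <= K -> C * K + B * m2 + 2 <= r -> enorm p <= r -> enorm p' <= r ->
  (forall (t : R) p q (l l' : R), `|t| <= M -> enorm p <= r -> enorm q <= r -> `|l| <= r ->
     `|l'| <= r -> `|F t p l - F t q l'| <= w (enorm (p - q) + `|l - l'|)) ->
  `|v y| <= M -> v y <= u x ->
  gamma * (u x - v y) <= f x - f y + w (enorm (p' - p) + e).
Proof.
move=> su sv tu tv e0 e1 H1 H2 pK p'K Kr pr p'r Hw vM vu.
have [|l [l1 l2 Fu Fv]] := split_level e0 su sv tu tv.
  have := leeD (leeD H1 H2) (lexx (e / 2)%:E).
  rewrite -!EFinD -[leRHS]addeA [leRHS]addeACA -EFinD (_ : e / 2 + e / 2 = e); last by lra.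
  by apply: le_trans; rewrite lee_fin; lra.
have [C0 _ _] := tu; have h1 := ler_wpM2l C0 pK; have h2 := ler_wpM2l C0 p'K.
(* The levels exceed [C * K + B * m2] by at most [2 e], and [e <= 1]; hence the [+ 2] in the
   condition on [r]. *)
have lr : `|l| <= r by rewrite ler_norml; apply/andP; split; lra.
have ler : `|l - e| <= r by rewrite ler_norml; apply/andP; split; lra.
have := Hw _ _ _ _ _ vM p'r pr lr ler.
rewrite (_ : l - (l - e) = e) ?(ger0_norm e0); last by ring.
by rewrite ler_norml => /andP[+ _]; have := Fgamma p' l vu; lra.
Qed.

Lemma comparison u v : continuous u -> continuous v -> boundedf u -> boundedf v ->
  parabolic_sub mu1 mu2 j1 j2 F f u -> parabolic_super mu1 mu2 j1 j2 F f v -> forall x, u x <= v x.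
Proof.
move=> cu cv [Mu uMu] [Mv vMv] su sv x0; rewrite leNgt; apply/negP => uv.
have aux (D d1 d2 W c : R) : D <= d1 - d2 + W -> W < gamma * c / 8 -> d1 - d2 < gamma * c / 8 ->
    gamma * (c / 2) <= D -> 0 < gamma * c -> False by lra.
pose M := `|Mu| + `|Mv| + 1.
have M0 : 0 < M by rewrite ltr_wpDl// addr_ge0.
have uM x : `|u x| <= M.
  by have := uMu x; have := ler_norm Mu; have := normr_ge0 Mv; rewrite /M; lra.
have vM x : `|v x| <= M.
  by have := vMv x; have := ler_norm Mv; have := normr_ge0 Mu; rewrite /M; lra.
pose m := u x0 - v x0.
have m0 : 0 < m by rewrite subr_gt0.
have gm0 : 0 < gamma * m / 8 by rewrite divr_gt0// mulr_gt0.
have [d d0 fd] := f_uc gm0.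
(* At the maxima [k|x - y|^2 < 2 M], so this value already forces [|x - y| < d]. *)
pose k := (2 * M + 1) / d ^+ 2.
have k0 : 0 < k by rewrite divr_gt0 ?exprn_gt0//; lra.
pose S := 4 * M.
have S0 : 0 < S by rewrite mulr_gt0.
have D0 := dotv_ge0 x0.
have mM : m <= 2 * M.
  have := uM x0; rewrite ler_norml => /andP[_ ?]; have := vM x0; rewrite ler_norml => /andP[? _].
  by rewrite /m; lra.
(* The penalty then costs at most [m / 2] at [x0] for every [t i <= t0], and the maxima stay at
   least [m / 2]. *)
pose t0 := m / 2 / (S * (dotv x0 x0 + 1)).
have S1 : 0 < S * (dotv x0 x0 + 1) by rewrite mulr_gt0// ltr_wpDl.
have t00 : 0 < t0 by rewrite !divr_gt0.
have tS : S * (t0 * dotv x0 x0) <= m / 2.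
  have -> : m / 2 = t0 * (S * (dotv x0 x0 + 1)) by rewrite /t0 divfK// gt_eqF.
  by rewrite mulrCA ler_pM2l// ler_pM2l// lerDl.
pose t i : R := t0 * i.+1%:R^-1.
have ti0 i : 0 < t i by rewrite mulr_gt0// invr_gt0.
have tt0 i : t i <= t0 by rewrite ler_piMr ?(ltW t00)// invf_le1// ler1n.
have tx0 i : S * (t i * dotv x0 x0) <= m / 2.
  by apply: le_trans tS; rewrite ler_pM2l// ler_wpM2r.
have psi0 i : S * psi (t i) x0 <= m / 2.
  by apply: le_trans (tx0 i); rewrite ler_pM2l//; apply: psi_le; exact: ltW.
have /choice[z Hz] : forall i, exists z : 'rV[R]_N * 'rV[R]_N, forall x y,
    u x - v y - k * dotv (x - y) (x - y) - S * psi (t i) x <=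
    u z.1 - v z.2 - k * dotv (z.1 - z.2) (z.1 - z.2) - S * psi (t i) z.1.
  move=> i; apply: (doubling_max (x0 := x0) (M := M)) => //.
  - by rewrite -(ler_pM2l S0); apply: (le_trans (tx0 i)); rewrite /S; lra.
  - by have := psi0 i; rewrite -/m; lra.
have zm i : m / 2 <= u (z i).1 - v (z i).2 - k * dotv ((z i).1 - (z i).2) ((z i).1 - (z i).2).
  have := Hz i x0 x0; rewrite subrr dotv0r mulr0 subr0 -/m => h.
  have := mulr_ge0 (ltW S0) (psi_ge0 (z i).1 (ltW (ti0 i))).
  by have := psi0 i; lra.
have zd i : k * dotv ((z i).1 - (z i).2) ((z i).1 - (z i).2) < 2 * M.
  have := uM (z i).1; rewrite ler_norml => /andP[_ ?].
  have := vM (z i).2; rewrite ler_norml => /andP[? _].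
  by have := zm i; lra.
pose q i := (2 * k) *: ((z i).1 - (z i).2).
have qb i : dotv (q i) (q i) <= 8 * k * M.
  by rewrite /q dotvZl dotvZr; have := ler_wpM2l (ltW k0) (ltW (zd i)); lra.
have [p [s [sk cp]]] := bounded_subsequence qb.
pose x i := (z (s i)).1; pose y i := (z (s i)).2.
pose ts i := t (s i).
have ts0 i : 0 < ts i by exact: ti0.
have tsle i : ts i <= t0 * i.+1%:R^-1.
  by rewrite ler_pM2l// lef_pV2 ?posrE// ler_nat ltnS; exact: sk.
pose pn i := q (s i); pose pn' i := pn i + S *: dpsi (ts i) (x i).
have tspos i := ltW (ts0 i).
have dpn i : dotv (pn' i - pn i) (pn' i - pn i) <= (S ^+ 2 * (4 * t0)) * i.+1%:R^-1.
  have h := dpsi_le (x i) (tspos i).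
  rewrite /pn' addrAC subrr add0r dotvZl dotvZr.
  rewrite [leRHS](_ : _ = S * (S * (4 * (t0 * i.+1%:R^-1)))); last by ring.
  rewrite (ler_pM2l S0) (ler_pM2l S0); apply: (le_trans h).
  by rewrite ler_pM2l.
have cdpn : (fun i => pn' i - pn i) @ \oo --> (0 : 'rV[R]_N).
  by apply: (@cvg_sqr_dist _ _ _ _ (S ^+ 2 * (4 * t0))) => i; rewrite subr0.
have cp' : pn' @ \oo --> p.
  rewrite (_ : pn' = fun i => pn i + (pn' i - pn i)); last first.
    by apply/funext => i; rewrite addrC subrK.
  by rewrite -[X in _ --> X]addr0; apply: cvgD.
have ineq i := doubling_ineq (tspos i) (ltW S0) (Hz (s i)).
have cts : S * ts i @[i --> \oo] --> (0 : R).
  apply: (@squeeze_cvgr _ _ _ _ (fun=> 0) (fun i => S * t0 * i.+1%:R^-1)).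
  - near=> i; rewrite mulr_ge0 ?(ltW S0) ?tspos//= -mulrA ler_pM2l//.
  - exact: cvg_cst.
  - exact: cvg_inv_nat.
(* Touching constants uniform in [i]: the doubling inequality has curvature at most [k + S * t0],
   and [B] bounds the oscillation of [u] and of [v]. *)
pose C := k + S * t0; pose B := 2 * M.
have St0 : 0 <= S * t0 by rewrite mulr_ge0// ltW.
have C0 : 0 <= C by rewrite addr_ge0// ltW.
have tu i : touch (\- u) (x i) (- pn' i) C B.
  split => // [a|a]; last first.
    rewrite gap_osc /=.
    have := uM (x i + a); rewrite ler_norml => /andP[_ ?].
    by have := uM (x i); rewrite ler_norml => /andP[? _]; rewrite /B; lra.
  have := ineq i a 0; rewrite -/(x i) -/(y i) -/(q (s i)) -/(pn i) -/(pn' i).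
  rewrite addr0 subrr dotv0r !subr0 /gap /= dotvNl.
  have : S * ts i * dotv a a <= S * t0 * dotv a a.
    by rewrite ler_wpM2r ?dotv_ge0// ler_pM2l//; exact: tt0.
  by rewrite /C; lra.
have tv i : touch v (y i) (pn i) C B.
  split => // [a|a]; last first.
    rewrite gap_osc /=.
    have := vM (y i + a); rewrite ler_norml => /andP[? _].
    by have := vM (y i); rewrite ler_norml => /andP[_ ?]; rewrite /B; lra.
  have := ineq i 0 a; rewrite -/(x i) -/(y i) -/(q (s i)) -/(pn i) -/(pn' i).
  rewrite (addr0 (x i)) (subrr (u (x i))) !dotv0r mulr0 (sub0r a) dotvNl dotvNr opprK /gap.
  have := mulr_ge0 St0 (dotv_ge0 a).
  by rewrite /C; lra.
(* One radius for the slopes near [p] and for the levels, with [J p + 1] bounding the second moments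
   near [p]. *)
pose r := 2 * enorm p + 2 + (C * (J p + 1) + B * m2 + 2).
have B0 : 0 <= B by rewrite mulr_ge0// ltW.
have Bm2 : 0 <= B * m2 by rewrite mulr_ge0// (mass2_ge0 hM).
have CJ : 0 <= C * (J p + 1) by rewrite mulr_ge0// addr_ge0// (jump_moment_ge0 hJ1).
have ep0 := enorm_ge0 p.
have r1 : 0 < 2 * enorm p + 2 by rewrite ltr_wpDl// mulr_ge0.
have r2 : 0 <= C * (J p + 1) + B * m2 + 2 by rewrite !addr_ge0.
have r0 : 0 < r by rewrite ltr_wpDr.
have [w [[w0 [_ wc]] Hw]] := F3 M0 r0.
have := @cvgr_lt _ _ _ _ _ _ wc _ gm0; rewrite near_withinE => -[dw /= dw0 Hdw].
(* The slopes will differ by less than [e], so the argument of [w] stays under [2 e < dw]. *)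
pose e := Num.min 1 (dw / 3).
have e0 : 0 < e by rewrite lt_min ltr01 divr_gt0.
have e1 : e <= 1 by rewrite ge_min lexx.
have ew : 2 * e < dw.
  by have : e <= dw / 3 by [rewrite ge_min lexx orbT]; lra.
have e2 : 0 < e / 2 by rewrite divr_gt0.
have gu i a : 0 <= gap 0 B (\- u) (x i) 0 a by have [] := tu i.
have gv i a : 0 <= gap 0 B v (y i) 0 a by have [] := tv i.
have n2 := int2_compare cu cv cp cp' cts gu gv ineq e2.
have Jp1 : 0 < J p + 1 by rewrite ltr_wpDl// (jump_moment_ge0 hJ1).
(* A quarter of [e] for the penalty's curvature, a quarter for the difference of the jumps: together
   the [e / 2] granted to the [j1] part. *)
have e4 : 0 < e / 4 / (J p + 1) by rewrite !divr_gt0.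
have ek : 0 < e / 4 / k by rewrite (divr_gt0 _ k0)// divr_gt0.
have [d1 d10 Hd1] := jump_equicontinuous hJ2 r1 ek.
have [d2 d20 Hd2] := jump_moment_usc hj1 hJ1 hJ2 p (@ltr01 R).
have near_cvg (rn : nat -> 'rV[R]_N) a c : rn @ \oo --> a -> 0 < c ->
    \forall i \near \oo, enorm (rn i - a) < c.
  by move=> cr c0; exact: (cr _ (near_enorm a c0)).
have pp0 c : 0 < c -> \forall i \near \oo, enorm (pn' i - pn i) < c.
  move=> c0; have := near_cvg _ _ _ cdpn c0.
  by apply: filterS => l; rewrite subr0.
near \oo => i.
have Hn2 : ((2 * B * m2 - e / 2)%:E <= int2 (\- u)%R (x i) (pn' i) B + int2 v (y i) (pn i) B)%E.
  by near: i.
have St1 : S * ts i < e / 4 / (J p + 1) by near: i; exact: (@cvgr_lt _ _ _ eventually_filter _ _ cts).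
have pb : enorm (pn i - p) < 1 by near: i; exact: near_cvg.
have pb' : enorm (pn' i - p) < 1 by near: i; exact: near_cvg.
have pj : enorm (pn i - p) < d2 by near: i; exact: near_cvg.
have pj' : enorm (pn' i - p) < d2 by near: i; exact: near_cvg.
have ppd : enorm (pn' i - pn i) < d1 by near: i; exact: pp0.
have ppe : enorm (pn' i - pn i) < e by near: i; exact: pp0.
have {}pb := enorm_lt_bound pb; have {}pb' := enorm_lt_bound pb'.
have {}pj := Hd2 _ pj; have {}pj' := Hd2 _ pj'.
have [_ tu1 _] := tu i; have [_ tv1 _] := tv i.
have Hn1 := int1_compare (pn' i) (pn i) (continuousN_fun cu) cv C0 (ltW k0)
  (mulr_ge0 (ltW S0) (tspos i)) tu1 tv1.
have {Hn1} Hn1 : ((C * J (pn' i) + C * J (pn i))%:E <=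
    int1 (\- u)%R (x i) (- pn' i)%R (pn' i) C + int1 v (y i) (pn i) (pn i) C + (e / 2)%:E)%E.
  apply: le_trans (Hn1 _) _.
    move=> a b; have := ineq i a b.
    rewrite -/(x i) -/(y i) -/(q (s i)) -/(pn i) -/(pn' i) /gap /= dotvNl; lra.
  apply: leeD2l.
  rewrite (_ : e / 2 = k * (e / 4 / k) + e / 4); last by field; rewrite gt_eqF.
  rewrite EFinD; apply: leeD; last first.
    rewrite lee_fin; apply: le_trans (_ : e / 4 / (J p + 1) * (J p + 1) <= _); last first.
      by rewrite divfK// gt_eqF.
    by apply: ler_pM; [exact: mulr_ge0 (ltW S0) (tspos i)|exact: (jump_moment_ge0 hJ1)|exact: ltW|exact: pj'].

  rewrite [X in (_ <= X)%E]EFinM; apply: lee_wpmul2l; first by rewrite lee_fin ltW.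
  exact: Hd1.
have Kr : C * (J p + 1) + B * m2 + 2 <= r by rewrite lerDr ltW.
have pr : enorm (pn i) <= r by rewrite (le_trans (ltW pb))// lerDl.
have pr' : enorm (pn' i) <= r by rewrite (le_trans (ltW pb'))// lerDl.
have uvm : m / 2 <= u (x i) - v (y i).
  apply: le_trans (zm (s i)) _; rewrite gerBl.
  by rewrite mulr_ge0 ?(ltW k0) ?dotv_ge0.
have uv' : v (y i) <= u (x i) by rewrite -subr_ge0; apply: le_trans uvm; rewrite divr_ge0 ?ltW.
have est := touching_estimate su sv (tu i) (tv i) (ltW e0) e1 Hn1 Hn2 pj pj' Kr pr pr' Hw
  (vM (y i)) uv'.
have wlt : w (enorm (pn' i - pn i) + e) < gamma * m / 8.
  apply: Hdw; last by rewrite /= ltr_wpDl ?enorm_ge0.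
  rewrite /= sub0r normrN ger0_norm ?addr_ge0 ?enorm_ge0 ?(ltW e0)//.
  by apply: lt_trans ew; rewrite mulr_natl mulr2n ltrD2r.
have xyd : enorm (x i - y i) < d.
  rewrite -(ltr_pXn2r (n := 2))// ?nnegrE ?enorm_ge0 ?ltW// sqr_enorm.
  rewrite -(ltr_pM2l k0); apply: (lt_le_trans (zd (s i))).
  by rewrite /k divfK ?gt_eqF ?exprn_gt0// lerDl.
have := fd _ _ xyd; rewrite ltr_norml => /andP[_ fxy].
have guv := ler_wpM2l (ltW gamma_gt0) uvm.
have gm : 0 < gamma * m by rewrite mulr_gt0.
exact: (aux _ _ _ _ _ est wlt fxy guv gm).
Unshelve. all: by end_near. Qed.

End Comparison.

(** * A second-order Taylor bound from continuous partial derivatives *)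

Section Taylor.
Variables (R : realType) (n : nat).
Implicit Types (g : 'rV[R]_n -> R) (x y h : 'rV[R]_n).

Lemma line_is_derive g i x (t : R) : derivable g (x + t *: evec R i) (evec R i) ->
  is_derive t 1 (fun s : R => g (x + s *: evec R i)) (partial i g (x + t *: evec R i)).
Proof.
move=> dg.
have E : (fun h : R => h^-1 *: (((fun s : R => g (x + s *: evec R i)) \o shift t) (h *: 1) - g (x + t *: evec R i)))
       = (fun h : R => h^-1 *: ((g \o shift (x + t *: evec R i)) (h *: evec R i) - g (x + t *: evec R i))).
  apply/funext => s; rewrite /=; congr (_ *: (g _ - _)).
  by rewrite scalerDl addrCA; congr (_ + (_ + _)); rewrite [s *: 1]mulr1.
split; first by rewrite /derivable E.
by rewrite /partial /derive E.
Qed.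

Lemma partial_mvt g i x (s : R) : continuous g -> (forall y, derivable g y (evec R i)) ->
  exists2 t : R, `|t| <= `|s| &
    g (x + s *: evec R i) - g x = s * partial i g (x + t *: evec R i).
Proof.
move=> cg dg; pose G (r : R) := g (x + r *: evec R i).
have dG r : is_derive r (1 : R) G (partial i g (x + r *: evec R i)) by exact: line_is_derive.
have cG : continuous G.
  move=> r; apply: (@continuous_comp _ _ _ (fun r : R => x + r *: evec R i) g); last exact: cg.
  apply: (@cvgD _ _ _ (nbhs r)); first exact: cvg_cst.
  by apply: (@cvgZ _ _ _ (nbhs r)); [exact: cvg_id|exact: cvg_cst].
have cGw (A : set R) : {within A, continuous G} by exact: continuous_subspaceT.
have G0 : G 0 = g x by rewrite /G scale0r addr0.
have [s0|s0] := leP 0 s.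
  have [t + E] := MVT_segment s0 (fun r _ => dG r) (cGw _).
  rewrite in_itv/= => /andP[t0 ts]; exists t; first by rewrite !ger0_norm.
  by rewrite -G0 -/(G s) E subr0 mulrC.
have [t + E] := MVT_segment (ltW s0) (fun r _ => dG r) (cGw _).
rewrite in_itv/= => /andP[ts t0]; exists t.
  by rewrite !ler0_norm ?lerN2// ltW.
by rewrite -G0 -/(G s) -opprB E sub0r mulrN opprK mulrC.
Qed.

(** A staircase from [x] to [x + h] changes one coordinate at a time, with the one-variable mean
    value theorem on each step. The intermediate offsets are dominated by [h] coordinatewise, hence
    in norm. *)
Lemma coordinate_mvt g x h : continuous g -> (forall i y, derivable g y (evec R i)) ->
  exists xi : 'I_n -> 'rV[R]_n, (forall i, enorm (xi i) <= enorm h) /\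
    g (x + h) - g x = \sum_i h 0 i * partial i g (x + xi i).
Proof.
move=> cg dg; pose T k : 'rV[R]_n := \row_i (if (i < k)%N then h 0 i else 0).
have T0 : T 0%N = 0 by apply/rowP => i; rewrite !mxE.
have Tn : T n = h by apply/rowP => i; rewrite !mxE ltn_ord.
have TS (i : 'I_n) : T i.+1 = T i + h 0 i *: evec R i.
  apply/rowP => k; rewrite !mxE eqxx /= ltnS leq_eqVlt.
  have [->|ki] := eqVneq k i; first by rewrite eqxx/= ltnn mulr1 add0r.
  by rewrite (negbTE (_ : (k : nat) != i)) ?mulr0 ?addr0.
have /choice[t Ht] : forall i : 'I_n, exists t : R, `|t| <= `|h 0 i| /\
    g (x + T i.+1) - g (x + T i) = h 0 i * partial i g (x + (T i + t *: evec R i)).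
  move=> i; have [t t1 t2] := @partial_mvt g i (x + T i) (h 0 i) cg (dg i).
  by exists t; split => //; rewrite TS !addrA.
exists (fun i : 'I_n => T i + t i *: evec R i); split.
  move=> i; rewrite -(ler_pXn2r (n := 2))// ?nnegrE ?enorm_ge0// !sqr_enorm.
  apply: ler_sum => k _; rewrite -!expr2 !mxE eqxx /=.
  have [->|ki] := eqVneq k i.
    rewrite ltnn mulr1 add0r -[leLHS]real_normK ?num_real// -[leRHS]real_normK ?num_real//.
    by rewrite ler_pXn2r// ?nnegrE//; have [] := Ht i.
  by rewrite mulr0 addr0; case: ifP => // _; rewrite expr0n sqr_ge0.
have -> : g (x + h) - g x = \sum_(0 <= k < n) (g (x + T k.+1) - g (x + T k)).
  by rewrite (telescope_sumr (fun k => g (x + T k)))// Tn T0 addr0.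
rewrite big_mkord; apply: eq_bigr => i _.
by have [_] := Ht i.
Qed.

Lemma local_bound g x : continuous g -> exists2 L : R, 0 <= L &
  exists2 d, 0 < d & forall h, enorm h < d -> `|g (x + h)| <= L.
Proof.
move=> cg; exists (`|g x| + 1) => //.
have [d d0 H] : exists2 d, 0 < d & forall y, enorm (y - x) < d -> `|g x - g y| < 1.
  by apply: near_enorm_ball; apply: (@cvgr_dist_lt _ _ _ (nbhs x) (nbhs_filter x) _ _ (@cg x)).
exists d => // h hd; have := H (x + h); rewrite [x + h - x]addrC addKr => /(_ hd) gh.
rewrite -[g (x + h)](subrK (g x)) (le_trans (ler_normD _ _))// addrC lerD2l distrC ltW//.
Qed.

Lemma finite_radius (Q : 'I_n -> R -> R -> Prop) :
  (forall i, exists2 L, 0 <= L & exists2 d, 0 < d & Q i L d) ->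
  (forall i L d d', d' <= d -> Q i L d -> Q i L d') ->
  exists2 L : 'I_n -> R, forall i, 0 <= L i & exists2 d, 0 < d & forall i, Q i (L i) d.
Proof.
move=> H mono.
have /choice[L HL] : forall i, exists L, 0 <= L /\ exists2 d, 0 < d & Q i L d.
  by move=> i; have [L L0 Hd] := H i; exists L.
have /choice[d Hd] : forall i, exists d, 0 < d /\ Q i (L i) d.
  by move=> i; have [_ [d d0 Qd]] := HL i; exists d.
exists L; first by move=> i; have [] := HL i.
(* Starting the minimum at 1 keeps the radius positive even when there is no coordinate. *)
exists (\big[Num.min/1]_i d i).
  by apply: lt_bigmin => // i _; have [] := Hd i.
move=> i; have [_] := Hd i; apply: mono; exact: bigmin_le_cond.
Qed.

Lemma local_lipschitz g x : continuous g -> (forall i y, derivable g y (evec R i)) ->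
  (forall i, continuous (partial i g)) -> exists2 L : R, 0 <= L &
  exists2 d, 0 < d & forall h, enorm h < d -> `|g (x + h) - g x| <= L * enorm h.
Proof.
move=> cg dg cdg.
have [||L L0 [d d0 H]] := @finite_radius
  (fun i L d => forall h, enorm h < d -> `|partial i g (x + h)| <= L).
- by move=> i; exact: local_bound.
- by move=> i L d d' dd H h hd; apply: H; exact: lt_le_trans dd.
exists (\sum_i L i); first exact: sumr_ge0.
exists d => // h hd; have [xi [xih ->]] := coordinate_mvt x h cg dg.
rewrite (le_trans (ler_norm_sum _ _ _))// mulr_suml; apply: ler_sum => i _.
rewrite normrM mulrC; apply: ler_pM => //; last exact: coord_le_enorm.
by apply: H; exact: le_lt_trans hd.
Qed.

(** The mean value theorem for [g], then the local Lipschitz bound of each partial derivative at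
    offsets no longer than [h]. *)
Lemma C2_taylor g x : C2 g -> exists2 L : R, 0 <= L &
  exists2 d, 0 < d & forall h, enorm h < d ->
    `|g (x + h) - g x - dotv (grad g x) h| <= L * dotv h h.
Proof.
move=> [cg Hg].
have [||L L0 [d d0 H]] := @finite_radius
  (fun i L d => forall h, enorm h < d -> `|partial i g (x + h) - partial i g x| <= L * enorm h).
- move=> i; have [_ [ci Hi]] := Hg i; apply: local_lipschitz => //.
    by move=> k; have [] := Hi k.
  by move=> k; have [] := Hi k.
- by move=> i L d d' dd H h hd; apply: H; exact: lt_le_trans dd.
exists (\sum_i L i); first exact: sumr_ge0.
exists d => // h hd.
have dg i : forall y, derivable g y (evec R i) by have [] := Hg i.
have [xi [xih ->]] := coordinate_mvt x h cg dg.
rewrite /dotv -sumrB (le_trans (ler_norm_sum _ _ _))// mulr_suml -/(dotv h h).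
apply: ler_sum => i _; rewrite mxE [X in _ - X]mulrC -mulrBr normrM -sqr_enorm expr2 mulrA mulrC.
have xd : enorm (xi i) < d by exact: le_lt_trans hd.
apply: ler_pM => //; last exact: coord_le_enorm.
by apply: (le_trans (H i _ xd)); rewrite ler_wpM2l.
Qed.

End Taylor.

(** * Paraboloids as test functions *)

Section Paraboloid.
Variables (R : realType) (n : nat).
Implicit Types (g : 'rV[R]_n -> R) (x y q v : 'rV[R]_n) (c C a : R).

Lemma derive_quadratic g y v a C : (forall h : R, g (h *: v + y) - g y = h * (a + C * h)) ->
  derivable g y v /\ 'D_v g y = a.
Proof.
move=> H.
have E : (h^-1 *: ((g \o shift y) (h *: v) - g y)) @[h --> 0^'] --> a.
  have ca : a + C * h @[h --> (0 : R)^'] --> a + C * 0.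
    apply: cvgD; first exact: cvg_cst.
    by apply: cvgM; [exact: cvg_cst|exact: nbhs_dnbhs].
  rewrite mulr0 addr0 in ca; apply: cvg_trans ca; apply: near_eq_cvg.
  near=> h; rewrite /= H.
  have h0 : h != 0 by near: h; exact: nbhs_dnbhs_neq.
  by rewrite /GRing.scale/= mulrA mulVf// mul1r.
split; first by apply/cvg_ex; exists a.
exact: cvg_lim E.
Unshelve. all: by end_near. Qed.

Definition paraboloid c q C x y := c + dotv q (y - x) + C * dotv (y - x) (y - x).

Lemma dotv_evec y i : dotv y (evec R i) = y 0 i.
Proof.
rewrite /dotv (bigD1 i)//= !mxE !eqxx mulr1 big1 ?addr0// => k ki.
by rewrite !mxE eqxx/= (negbTE ki) mulr0.
Qed.

Lemma paraboloid_partial c q C x i y :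
  derivable (paraboloid c q C x) y (evec R i) /\
  partial i (paraboloid c q C x) y = q 0 i + 2 * C * (y - x) 0 i.
Proof.
rewrite /partial; apply: (@derive_quadratic _ _ _ _ C) => h; rewrite /paraboloid.
have -> : h *: evec R i + y - x = (y - x) + h *: evec R i by rewrite -addrA addrC.
move: (y - x) => d; rewrite !dotvE (dotvC (evec R i) d) !dotv_evec.
have ei : evec R i 0 i = 1 :> R by rewrite mxE !eqxx.
by rewrite ei; ring.
Qed.

Lemma paraboloid_partial2 c q C x i k y :
  derivable (partial i (paraboloid c q C x)) y (evec R k) /\
  partial k (partial i (paraboloid c q C x)) y = 2 * C * evec R k 0 i.
Proof.
rewrite /partial; apply: (@derive_quadratic _ _ _ _ 0) => h.
have E z := (paraboloid_partial c q C x i z).2.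
rewrite /partial in E; rewrite !E !mxE; ring.
Qed.

Lemma paraboloid_C2 c q C x : C2 (paraboloid c q C x).
Proof.
have cd : continuous (fun y : 'rV[R]_n => y - x) by exact: continuous_addr.
split.
  move=> y; apply: (@cvgD _ _ _ (nbhs y)).
    apply: (@cvgD _ _ _ (nbhs y)); first exact: cvg_cst.
    by apply: (@cvg_dotv _ _ _ (nbhs y)); [exact: cvg_cst|exact: cd].
  apply: (@cvgM _ _ (nbhs y)); first exact: cvg_cst.
  by apply: (@cvg_dotv _ _ _ (nbhs y)); exact: cd.
move=> i; split; first by move=> y; have [] := paraboloid_partial c q C x i y.
have -> : partial i (paraboloid c q C x) = fun y => q 0 i + 2 * C * (y - x) 0 i.
  by apply/funext => y; have [] := paraboloid_partial c q C x i y.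
split.
  move=> y; apply: (@cvgD _ _ _ (nbhs y)); first exact: cvg_cst.
  apply: (@cvgM _ _ (nbhs y)); first exact: cvg_cst.
  apply: (@continuous_comp _ _ _ (fun y => y - x) (fun a : 'rV[R]_n => a 0 i)); first exact: cd.
  exact: coord_continuous.
move=> k; split.
  move=> y; have [+ _] := paraboloid_partial2 c q C x i k y.
  by rewrite (_ : partial i _ = fun y => q 0 i + 2 * C * (y - x) 0 i)//;
    apply/funext => z; have [] := paraboloid_partial c q C x i z.
have -> : partial k (fun y : 'rV[R]_n => q 0 i + 2 * C * (y - x) 0 i) = cst (2 * C * evec R k 0 i).
  apply/funext => y; have [_ <-] := paraboloid_partial2 c q C x i k y.
  by congr partial; apply/funext => z; have [_ ->] := paraboloid_partial c q C x i z.
exact: cst_continuous.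
Qed.

Lemma paraboloid_grad c q C x : grad (paraboloid c q C x) x = q.
Proof.
apply/rowP => i; rewrite mxE; have [_ ->] := paraboloid_partial c q C x i x.
by rewrite subrr mxE mulr0 addr0.
Qed.

End Paraboloid.

(** * Integrable functions of either sign below nonnegative ones *)

Section IntegrableUpperBound.

Lemma integral_le_of_integrable (d : measure_display) (T : measurableType d) (R : realType)
    (mu : {measure set T -> \bar R}) (D : set T) (f g : T -> R) :
  measurable D -> mu.-integrable D (EFin \o f) -> measurable_fun D g ->
  (forall x, D x -> 0 <= g x) -> (forall x, D x -> f x <= g x) ->
  (\int[mu]_(x in D) (f x)%:E <= \int[mu]_(x in D) (g x)%:E)%E.
Proof.
move=> mD fi mg g0 fg.
have [goo|] := ltP (\int[mu]_(x in D) (g x)%:E)%E +oo%E; last first.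
  by rewrite leye_eq => /eqP ->; rewrite leey.
apply: le_integral => //.
  apply/integrableP; split; first by apply/measurable_EFinP.
  by under eq_integral => x /set_mem Dx do rewrite gee0_abs ?lee_fin ?g0//.
by move=> x /set_mem Dx; rewrite lee_fin fg.
Qed.

Lemma EFin_Rintegral (d : measure_display) (T : measurableType d) (R : realType)
    (mu : {measure set T -> \bar R}) (D : set T) (f : T -> R) :
  measurable D -> mu.-integrable D (EFin \o f) ->
  ((Rintegral mu D f)%:E = \int[mu]_(x in D) (f x)%:E)%E.
Proof. by move=> mD fi; rewrite /Rintegral fineK//; exact: integrable_fin_num. Qed.

End IntegrableUpperBound.

(** * Equivalence of the viscosity and parabolic notions for continuous functions *)

Section ViscosityEquivalence.
Variables (R : realType) (N P : nat).
Variables (mu1 mu2 : {measure set (borelRV R P) -> \bar R}).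
Variables (j1 j2 : 'rV[R]_N -> 'rV[R]_P -> 'rV[R]_N).
Variables (F : R -> 'rV[R]_N -> R -> R) (f : 'rV[R]_N -> R).
Implicit Types (g u v phi : 'rV[R]_N -> R) (x y q p a b : 'rV[R]_N) (B C m l e d : R).

Notation below := (nonlocal_ge mu1 mu2 j1 j2).
Notation int1 := (gap_int1 mu1 j1).
Notation int2 := (gap_int2 mu2 j2).
Notation J := (jump_moment mu1 j1).
Notation m2 := (mass2 mu2).

Hypothesis hj1 : borel_measurable (fun pz : 'rV[R]_N * 'rV[R]_P => j1 pz.1 pz.2).
Hypothesis hj2 : borel_measurable (fun pz : 'rV[R]_N * 'rV[R]_P => j2 pz.1 pz.2).
Hypothesis hM : hypM mu1 mu2.
Hypothesis hJ1 : hypJ1 mu1 mu2 j1 j2.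
Hypothesis hJ2 : hypJ2 mu1 j1.

(** Chebyshev's inequality with the second moment of (M). *)
Lemma far0_lty d : 0 < d -> (mu1 (@far0 R P d) < +oo)%E.
Proof.
move=> d0; have [h _] := hM.
have mF := @measurable_far0 R P d.
have d2 : 0 < d ^+ 2 by rewrite exprn_gt0.
have me D : measurable_fun D (fun z : borelRV R P => (enorm (z : 'rV[R]_P) ^+ 2)%:E).
  (* [|z|^2] is measurable as the squared jump of the family [j p z = z]. *)
  have hid : borel_measurable (fun pz : 'rV[R]_P * 'rV[R]_P => pz.2).
    by move=> U oU; apply: sub_sigma_algebra; apply: open_comp => // z _; exact: cvg_snd.
  have H := @measurable_jump R P P (fun _ z => z) hid _ 0 D (@continuous_sqnorm R P).
  by apply/measurable_EFinP; apply: eq_measurable_fun H => z _; rewrite sqr_enorm.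
have : ((d ^+ 2)%:E * mu1 (@far0 R P d) < +oo)%E.
  rewrite -integral_cst//; apply: le_lt_trans h.
  apply: (@le_trans _ _ (\int[mu1]_(z in @far0 R P d) (enorm (z : 'rV[R]_P) ^+ 2)%:E)%E).
    apply: ge0_le_integral => //.
    - by move=> z _; rewrite lee_fin ltW.
    - by move=> z /= zd; rewrite lee_fin ler_pXn2r// nnegrE ?enorm_ge0// ltW.
  apply: ge0_subset_integral => //; first exact: measurable_punct.
    by move=> z _; rewrite lee_fin sqr_ge0.
  by rewrite (punctE P d0) => z; right.
have := measure_ge0 mu1 (@far0 R P d).
by case: (mu1 (@far0 R P d)) => [r| |]//= _ ; rewrite ?ltry ?gt0_muley ?lte_fin.
Qed.

Lemma sqjump_integrable p (D : set (borelRV R P)) : measurable D -> D `<=` @punct R P ->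
  mu1.-integrable D (EFin \o (fun z : borelRV R P => dotv (j1 p z) (j1 p z))).
Proof.
move=> mD DP; apply: (integrableS (@measurable_punct R P) mD DP).
apply/integrableP; split.
  by apply/measurable_EFinP; exact: measurable_sqjump.
under eq_integral => z _ do rewrite /= ger0_norm ?dotv_ge0//.
exact: (moment_lty hJ1 p).
Qed.

Lemma ball0_integrableZ p d C : 0 < d ->
  mu1.-integrable (@Defs.ball0 R P d) (EFin \o (fun z : borelRV R P => C * dotv (j1 p z) (j1 p z))).
Proof.
move=> d0; have mB := @measurable_ball0 R P d.
have BP : @Defs.ball0 R P d `<=` @punct R P by rewrite (punctE P d0) => z; left.
have i1 := sqjump_integrable p mB BP.
rewrite (_ : _ \o _ = (fun z : borelRV R P => C%:E * (EFin \o (fun z : borelRV R P => dotv (j1 p z) (j1 p z))) z)%E); last by [].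
exact: integrableZl.
Qed.

(** The linear term is dominated by [|q|^2 + |j1|^2]: constants are integrable because [mu1] has
    finite mass away from 0, the square by (J1). *)
Lemma far_integrable g M x q p d : continuous g -> (forall y, `|g y| <= M) -> 0 < d ->
  mu1.-integrable (@far0 R P d)
    (EFin \o (fun z : borelRV R P => g (x + j1 p z) - g x - dotv q (j1 p z))).
Proof.
move=> cg gM d0; have mF := @measurable_far0 R P d.
have FP : @far0 R P d `<=` @punct R P by rewrite (punctE P d0) => z; right.
have M0 : 0 <= M by exact: le_trans (gM x).
pose K := 2 * M + dotv q q.
have K0 : 0 <= K by rewrite addr_ge0 ?mulr_ge0 ?dotv_ge0.
have i1 : mu1.-integrable (@far0 R P d) (EFin \o (fun z : borelRV R P => K + dotv (j1 p z) (j1 p z))).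
  rewrite (_ : _ \o _ = cst K%:E \+ (EFin \o (fun z : borelRV R P => dotv (j1 p z) (j1 p z))))%E; last by [].
  apply: integrableD => //; last exact: sqjump_integrable.
  apply/integrableP; split; first exact: measurable_cst.
  under eq_integral => z _ do rewrite /= ger0_norm//.
  by rewrite integral_cst// lte_mul_pinfty// far0_lty.
apply: (le_integrable mF _ _ i1).
  apply/measurable_EFinP.
  rewrite (_ : (fun z => _) = fun z : borelRV R P => gap 0 0 g x q (j1 p z)); last first.
    by apply/funext => z; rewrite /gap mul0r !add0r.
  exact: measurable_gap1.
move=> z _ /=; rewrite lee_fin (ger0_norm (addr_ge0 K0 (dotv_ge0 _))) /K.
have := gM (x + j1 p z); have := gM x; rewrite !ler_norml => /andP[? ?] /andP[? ?].
have := dotv2_le q (j1 p z); have := dotv2_le (- q) (j1 p z).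
rewrite !dotvNl dotvNr opprK; have := dotv_ge0 q; have := dotv_ge0 (j1 p z).
by move=> *; apply/andP; split; lra.
Qed.

Lemma punct2_integrable g M x p : continuous g -> (forall y, `|g y| <= M) ->
  mu2.-integrable (@punct R P) (EFin \o (fun z : borelRV R P => g (x + j2 p z) - g x)).
Proof.
move=> cg gM; have mP := @measurable_punct R P.
have M0 : 0 <= M by exact: le_trans (gM x).
have i1 : mu2.-integrable (@punct R P) (EFin \o (cst (2 * M) : borelRV R P -> R)).
  apply/integrableP; split; first by apply/measurable_EFinP; exact: measurable_cst.
  under eq_integral => z _ do rewrite /= ger0_norm ?mulr_ge0//.
  by rewrite (integral_cst_mu2 hM) ltry.
apply: (le_integrable mP _ _ i1).
  apply/measurable_EFinP.
  rewrite (_ : (fun z => _) = fun z : borelRV R P => gap 0 0 g x 0 (j2 p z)); last first.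
    by apply/funext => z; rewrite gap_osc add0r.
  exact: measurable_gap2.
move=> z _ /=; rewrite lee_fin [leRHS]ger0_norm ?mulr_ge0//.
have := gM (x + j2 p z); have := gM x; rewrite !ler_norml => /andP[? ?] /andP[? ?].
by apply/andP; split; lra.
Qed.

(* [chi] stands for the integrand of the test function on the small ball. *)
Lemma splitting_identity g M x q p C B d (chi : borelRV R P -> R) :
  continuous g -> (forall y, `|g y| <= M) -> 0 < d -> touch g x q C B ->
  mu1.-integrable (@Defs.ball0 R P d) (EFin \o chi) ->
  ((Rintegral mu1 (@Defs.ball0 R P d) chi +
    Rintegral mu1 (@far0 R P d) (fun z : borelRV R P => g (x + j1 p z) - g x - dotv q (j1 p z)) +
    Rintegral mu2 (@punct R P) (fun z : borelRV R P => g (x + j2 p z) - g x) +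
    C * J p + B * m2)%:E =
   \int[mu1]_(z in @Defs.ball0 R P d) (C * dotv (j1 p z) (j1 p z) + chi z)%:E +
   \int[mu1]_(z in @far0 R P d) (gap C 0 g x q (j1 p z))%:E + int2 g x p B)%E.
Proof.
move=> cg gM d0 tg chii; have [C0 tg1 tg2] := tg.
have mP := @measurable_punct R P.
have mF := @measurable_far0 R P d; have mB := @measurable_ball0 R P d.
have FP : @far0 R P d `<=` @punct R P by rewrite (punctE P d0) => z; right.
have BP : @Defs.ball0 R P d `<=` @punct R P by rewrite (punctE P d0) => z; left.
pose sq (z : borelRV R P) := dotv (j1 p z) (j1 p z).
have sqi D (mD : measurable D) (DP : D `<=` @punct R P) := @sqjump_integrable p D mD DP.
have Csqi D : measurable D -> D `<=` @punct R P -> mu1.-integrable D (EFin \o (fun z => C * sq z)).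
  move=> mD DP; rewrite (_ : _ \o _ = (fun z => C%:E * (EFin \o sq) z)%E); last by [].
  by apply: integrableZl => //; exact: sqi.
have fi := far_integrable x q p cg gM d0.
have p2 := punct2_integrable x p cg gM.
have JE : C * J p = Rintegral mu1 (@Defs.ball0 R P d) (fun z => C * sq z) +
    Rintegral mu1 (@far0 R P d) (fun z => C * sq z).
  rewrite !RintegralZl//; [|exact: sqi|exact: sqi].
  rewrite -mulrDr; congr (_ * _).
  have disj := @ball0_far0_disj R P d.
  by rewrite -Rintegral_setU// -?(punctE P d0)//; exact: sqi.
have e1 : (\int[mu1]_(z in @Defs.ball0 R P d) (C * sq z + chi z)%:E =
   (Rintegral mu1 (@Defs.ball0 R P d) (fun z => C * sq z) + Rintegral mu1 (@Defs.ball0 R P d) chi)%:E)%E.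
  rewrite -RintegralD//; last exact: Csqi.
  rewrite EFin_Rintegral//; apply: eq_integrable (integrableD mB (Csqi _ mB BP) chii) => //.
have e2 : (\int[mu1]_(z in @far0 R P d) (gap C 0 g x q (j1 p z))%:E =
   (Rintegral mu1 (@far0 R P d) (fun z => C * sq z) +
    Rintegral mu1 (@far0 R P d) (fun z : borelRV R P => g (x + j1 p z) - g x - dotv q (j1 p z)))%:E)%E.
  rewrite -RintegralD//; last exact: Csqi.
  rewrite EFin_Rintegral//; last exact: integrableD (Csqi _ mF FP) fi.
  by apply: eq_integral => z _; congr EFin; rewrite /gap /sq; ring.
have e3 : (int2 g x p B = (B * m2 +
    Rintegral mu2 (@punct R P) (fun z : borelRV R P => g (x + j2 p z) - g x))%:E)%E.
  have ci : mu2.-integrable (@punct R P) (EFin \o (cst B : borelRV R P -> R)).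
    apply/integrableP; split; first by apply/measurable_EFinP; exact: measurable_cst.
    under eq_integral => z _ do rewrite /= ger0_norm ?(touch_B_ge0 tg)//.
    by rewrite (integral_cst_mu2 hM) ltry.
  have -> : B * m2 = Rintegral mu2 (@punct R P) (cst B).
    by rewrite /Rintegral (integral_cst_mu2 hM).
  rewrite -RintegralD// EFin_Rintegral//; last exact: integrableD ci p2.
  by apply: eq_integral => z _; congr EFin; rewrite gap_osc.
by rewrite e1 e2 e3 -!EFinD JE; congr EFin; ring.
Qed.

(** On the small ball the integrand of the test function lies below that of [g]; once compensated it
    can be replaced by the gap, whose integral may be infinite. *)
Lemma below_of_splitting g M x q p C B d (chi : borelRV R P -> R) :
  continuous g -> (forall y, `|g y| <= M) -> 0 < d -> touch g x q C B ->
  mu1.-integrable (@Defs.ball0 R P d) (EFin \o chi) ->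
  (forall z, Defs.ball0 d z -> chi z <= g (x + j1 p z) - g x - dotv q (j1 p z)) ->
  below g x q p C B
   (Rintegral mu1 (@Defs.ball0 R P d) chi +
    Rintegral mu1 (@far0 R P d) (fun z : borelRV R P => g (x + j1 p z) - g x - dotv q (j1 p z)) +
    Rintegral mu2 (@punct R P) (fun z : borelRV R P => g (x + j2 p z) - g x)).
Proof.
move=> cg gM d0 tg chii chile; have [C0 tg1 tg2] := tg.
have mF := @measurable_far0 R P d; have mB := @measurable_ball0 R P d.
have BP : @Defs.ball0 R P d `<=` @punct R P by rewrite (punctE P d0) => z; left.
rewrite /nonlocal_ge (splitting_identity p cg gM d0 tg chii); apply: leeD => //.
rewrite /int1 (punctE P d0) ge0_integral_setU//; last 3 first.
- by apply/measurable_EFinP; exact: measurable_gap1.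
- by move=> z _; rewrite lee_fin.
- exact: ball0_far0_disj.
apply: leeD => //; apply: integral_le_of_integrable => //.
- have i2 := ball0_integrableZ p C d0.
  exact: (integrableD mB i2 chii).
- exact: measurable_gap1.
- by move=> z /chile; rewrite /gap; lra.
Qed.

(** Testing with the paraboloid discards the gap on the small ball. The truncated gaps [h k] exhaust
    the full gap, so Fatou's lemma finds a radius at which at most [e] of the lower bound [m] is
    lost, even if the total is infinite. *)
Lemma splitting_of_below g M x q p C B m e : continuous g -> (forall y, `|g y| <= M) ->
  touch g x q C B -> below g x q p C B m -> 0 < e ->
  exists2 d, 0 < d & m - e <=
    Rintegral mu1 (@Defs.ball0 R P d) (fun z : borelRV R P => - C * dotv (j1 p z) (j1 p z)) +
    Rintegral mu1 (@far0 R P d) (fun z : borelRV R P => g (x + j1 p z) - g x - dotv q (j1 p z)) +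
    Rintegral mu2 (@punct R P) (fun z : borelRV R P => g (x + j2 p z) - g x).
Proof.
move=> cg gM tg H e0; have [C0 tg1 tg2] := tg.
have mP := @measurable_punct R P.
have I10 : (0 <= int1 g x q p C)%E by apply: integral_ge0 => z _; rewrite lee_fin.
have I20 : (0 <= int2 g x p B)%E by apply: integral_ge0 => z _; rewrite lee_fin.
have [a1 [a2 [ha1 ha2 ha]]] := le_adde_fin e0 I10 I20 H.
pose h k (z : borelRV R P) : R := if k.+1%:R^-1 <= enorm (z : 'rV[R]_P) then gap C 0 g x q (j1 p z) else 0.
have d0 k : (0 : R) < k.+1%:R^-1 by rewrite invr_gt0.
have hE k : (\int[mu1]_(z in @punct R P) (h k z)%:E =
    \int[mu1]_(z in @far0 R P k.+1%:R^-1) (gap C 0 g x q (j1 p z))%:E)%E /\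
    measurable_fun (@punct R P) (h k).
  have mF := @measurable_far0 R P k.+1%:R^-1; have mB := @measurable_ball0 R P k.+1%:R^-1.
  have mh : measurable_fun (@punct R P) (h k).
    rewrite (punctE P (d0 k)); apply/measurable_funU => //; split.
      apply: (eq_measurable_fun (cst 0 : borelRV R P -> R)); last exact: measurable_cst.
      by move=> z /set_mem /= /andP[_ zd]; rewrite /h leNgt zd.
    apply: (eq_measurable_fun (fun z : borelRV R P => gap C 0 g x q (j1 p z))).
      by move=> z /set_mem /= zd; rewrite /h zd.
    exact: measurable_gap1.
  split => //; rewrite (punctE P (d0 k)) ge0_integral_setU//; last 3 first.
  - by rewrite -(punctE P (d0 k)); apply/measurable_EFinP.
  - by move=> z _; rewrite lee_fin /h; case: ifP.
  - exact: ball0_far0_disj.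
  rewrite integral0_eq ?add0e; last first.
    by move=> z /= /andP[_ zd]; rewrite /h leNgt zd.
  by apply: eq_integral => z /set_mem /= zd; rewrite /h zd.
have : \forall k \near \oo, (a1%:E <= \int[mu1]_(z in @punct R P) (h k z)%:E)%E.
  apply: (fatou_near (f := h) (g := fun z : borelRV R P => gap C 0 g x q (j1 p z))) => //.
  - by move=> k; have [] := hE k.
  - exact: measurable_gap1.
  - by move=> k z _; rewrite /h; case: ifP.
  - apply: (@aeW _ _ _ mu1) => z /= z0 c c0.
    have := @cvgr_lt _ _ _ eventually_filter _ _ (@cvg_inv_nat R 1) _ z0.
    apply: filterS => k; rewrite mul1r => /ltW zk.
    by rewrite /h zk gerBl ltW.
case=> k _ /(_ k (leqnn k)) /=; rewrite (hE k).1 => Hk.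
exists k.+1%:R^-1 => //.
have i2 := ball0_integrableZ p (- C) (d0 k).
have := splitting_identity p cg gM (d0 k) tg i2.
rewrite [X in (X + _ + _)%E]integral0_eq; last by move=> z _; rewrite -mulrDl subrr mul0r.
rewrite add0e => E; have := leeD Hk (ltW ha2); rewrite -E -EFinD lee_fin.
by lra.
Qed.

(** Beyond radius [d] the term [c|a|^2], with [c * d^2 = 2 M + |q|^2], and the extra [|a|^2] pay for
    the oscillation of [g] and for the linear term. Local contact with a [C2] function thus becomes
    global contact with a paraboloid. *)
Lemma touch_global g M x q L d : (forall y, `|g y| <= M) -> 0 <= L -> 0 < d ->
  (forall a, enorm a < d -> 0 <= gap L 0 g x q a) -> exists C, touch g x q C (2 * M).
Proof.
move=> gM L0 d0 H; have M0 : 0 <= M by exact: le_trans (gM x).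
have osc a : - (2 * M) <= g (x + a) - g x.
  have := gM (x + a); have := gM x; rewrite !ler_norml => /andP[? ?] /andP[? ?]; lra.
have d2 : 0 < d ^+ 2 by rewrite exprn_gt0.
pose c := (2 * M + dotv q q) / d ^+ 2.
have c0 : 0 <= c by rewrite divr_ge0 ?(ltW d2)// addr_ge0 ?mulr_ge0 ?dotv_ge0.
exists (L + 1 + c); split => [|a|a]; [by rewrite !addr_ge0| |by rewrite gap_osc; have := osc a; lra].
have a0 := dotv_ge0 a; have La0 := mulr_ge0 L0 a0; have ca0 := mulr_ge0 c0 a0.
have [ad|da] := ltP (enorm a) d; first by have := H a ad; rewrite /gap; lra.
have : c * d ^+ 2 <= c * dotv a a.
  by rewrite ler_wpM2l// -sqr_enorm ler_pXn2r// nnegrE ?enorm_ge0// ltW.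
rewrite /c divfK ?gt_eqF// -/c.
by have := dotv2_le q a; have := osc a; have := dotv_ge0 q; rewrite /gap; lra.
Qed.

Lemma RintegralN (mu : {measure set (borelRV R P) -> \bar R}) D (h : borelRV R P -> R) :
  measurable D -> mu.-integrable D (EFin \o h) ->
  Rintegral mu D (fun z => - h z) = - Rintegral mu D h.
Proof.
move=> mD hi; rewrite -mulN1r -RintegralZl//.
by apply: eq_Rintegral => z _; rewrite mulN1r.
Qed.

Hypothesis Fcont : continuous (fun t : R * 'rV[R]_N * R => F t.1.1 t.1.2 t.2).
Hypothesis Fmono : forall (u : R) p l l', l <= l' -> F u p l' <= F u p l.

Notation visc_sub := (visc_sub mu1 mu2 j1 j2 F f).
Notation visc_super := (visc_super mu1 mu2 j1 j2 F f).
Notation psub := (parabolic_sub mu1 mu2 j1 j2 F f).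
Notation psuper := (parabolic_super mu1 mu2 j1 j2 F f).

Lemma continuous_usc u : continuous u -> usc u.
Proof.
move=> cu x e e0; apply: (@cvgr_lt _ _ _ (nbhs_filter x) _ _ (@cu x)).
by rewrite ltrDl.
Qed.

Lemma continuous_lsc u : continuous u -> lsc u.
Proof.
move=> cu x e e0; apply: (@cvgr_gt _ _ _ (nbhs_filter x) _ _ (@cu x)).
by rewrite ltrBlDr ltrDl.
Qed.

Lemma LfarE d u p x : Lfar mu1 j1 d u p x =
  Rintegral mu1 (@far0 R P d) (fun z : borelRV R P => u (x + j1 p z) - u x - dotv p (j1 p z)).
Proof. by apply: eq_Rintegral => z _; rewrite /integ1 dotvC. Qed.

Lemma psub_visc_sub u : continuous u -> boundedf u -> psub u -> visc_sub u.
Proof.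
move=> cu bu su; split => //; split; first exact: continuous_usc.
move=> d phi x d0 C2phi umax [i1 [i2 i3]]; have [M uM] := bu.
set p := grad phi x in i1 i2 i3 *.
have mF := @measurable_far0 R P d; have mB := @measurable_ball0 R P d.
have mP := @measurable_punct R P.
have cg := continuousN_fun cu.
have gM y : `|(\- u) y| <= M by rewrite normrN.
have phiu a : - (phi (x + a) - phi x) <= - u (x + a) - - u x.
  by have := umax (x + a); lra.
have [L L0 [r r0 Tay]] := C2_taylor x C2phi.
have [|C tg] := @touch_global (\- u) M x (- p) L r gM L0 r0 _.
  move=> a ar; have := Tay a ar; rewrite ler_norml => /andP[_].
  by have := phiu a; rewrite /gap dotvNl /= -/p; lra.
have chii : mu1.-integrable (@Defs.ball0 R P d) (EFin \o (fun z => - integ1 j1 phi p x z)).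
  by rewrite (_ : _ \o _ = \- (EFin \o integ1 j1 phi p x))%E; [exact: integrableN|].
have E1 := RintegralN mB i1.
have E2 : Rintegral mu1 (@far0 R P d) (fun z : borelRV R P =>
    (\- u) (x + j1 p z) - (\- u) x - dotv (- p) (j1 p z)) = - Lfar mu1 j1 d u p x.
  by rewrite -RintegralN//; apply: eq_Rintegral => z _; rewrite /integ1 dotvNl (dotvC p) /=; ring.
have E3 : Rintegral mu2 (@punct R P) (fun z : borelRV R P =>
    (\- u) (x + j2 p z) - (\- u) x) = - L2 mu2 j2 u p x.
  by rewrite -RintegralN//; apply: eq_Rintegral => z _; rewrite /integ2 /=; ring.
have := below_of_splitting (p := p) cg gM d0 tg chii _.
rewrite E1 E2 E3 -!opprD => H; apply: (su _ _ _ _ _ tg); apply: H => z _.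
by have := phiu (j1 p z); rewrite /integ1 dotvNl (dotvC p) /=; lra.
Qed.

Lemma psuper_visc_super u : continuous u -> boundedf u -> psuper u -> visc_super u.
Proof.
move=> cu bu su; split => //; split; first exact: continuous_lsc.
move=> d phi x d0 C2phi umin [i1 [i2 i3]]; have [M uM] := bu.
set p := grad phi x in i1 i2 i3 *.
have phiu a : phi (x + a) - phi x <= u (x + a) - u x.
  by have := umin (x + a); lra.
have [L L0 [r r0 Tay]] := C2_taylor x C2phi.
have [|C tg] := @touch_global u M x p L r uM L0 r0 _.
  move=> a ar; have := Tay a ar; rewrite ler_norml => /andP[+ _].
  by have := phiu a; rewrite /gap -/p; lra.
apply: (su _ _ _ _ _ tg); rewrite LfarE; apply: (below_of_splitting cu uM d0 tg i1) => z _.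
by have := phiu (j1 p z); rewrite /integ1 (dotvC p); lra.
Qed.

Lemma paraboloid_integ1 u p x C z :
  integ1 j1 (paraboloid (u x) p C x) p x z = C * dotv (j1 p z) (j1 p z).
Proof.
have E : x + j1 p z - x = j1 p z by rewrite addrAC subrr add0r.
by rewrite /integ1 /paraboloid E subrr !dotv0r (dotvC p); ring.
Qed.

Lemma nonlocal_defined_paraboloid u p x C d : continuous u -> boundedf u -> 0 < d ->
  nonlocal_defined mu1 mu2 j1 j2 d (paraboloid (u x) p C x) u x.
Proof.
move=> cu [M uM] d0; rewrite /nonlocal_defined paraboloid_grad; split.
  rewrite (_ : integ1 j1 _ p x = fun z : borelRV R P => C * dotv (j1 p z) (j1 p z)).
    exact: ball0_integrableZ.
  by apply/funext => z; exact: paraboloid_integ1.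
split; last exact: (punct2_integrable x p cu uM).
rewrite (_ : integ1 j1 u p x = fun z : borelRV R P => u (x + j1 p z) - u x - dotv p (j1 p z)).
  exact: (far_integrable x p p cu uM d0).
by apply/funext => z; rewrite /integ1 dotvC.
Qed.

(** The touching paraboloid itself is the test function, on a ball so small that the splitting loses
    at most [e]. *)
Lemma visc_sub_psub u : continuous u -> visc_sub u -> psub u.
Proof.
move=> cu [bu [_ su]] x p C B l tg H; have [M uM] := bu; have [C0 tg1 tg2] := tg.
apply: (F_right_le Fcont) => e e0.
have cg := continuousN_fun cu.
have gM y : `|(\- u) y| <= M by rewrite normrN.
have [d d0 le] := splitting_of_below cg gM tg H e0.
have [] := nonlocal_defined_paraboloid p x C cu bu d0; rewrite paraboloid_grad => i1 [i2 i3].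
have mF := @measurable_far0 R P d; have mB := @measurable_ball0 R P d.
have mP := @measurable_punct R P.
have := su d (paraboloid (u x) p C x) x d0 (paraboloid_C2 _ _ _ _) _
  (nonlocal_defined_paraboloid p x C cu bu d0).
rewrite paraboloid_grad => Hs; apply: le_trans (Hs _); last first.
  move=> y; rewrite /paraboloid subrr !dotv0r mulr0 !addr0 subrr.
  have := tg1 (y - x); rewrite /gap (addrC x) subrK dotvNl /=; lra.
apply: Fmono; rewrite -lerN2 opprD; apply: (le_trans le).
have -> : Rintegral mu1 (@Defs.ball0 R P d) (fun z : borelRV R P => - C * dotv (j1 p z) (j1 p z)) =
    - Lloc mu1 j1 d (paraboloid (u x) p C x) x.
  rewrite /Lloc paraboloid_grad -RintegralN//; apply: eq_Rintegral => z _.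
  by rewrite paraboloid_integ1 mulNr.
have -> : Rintegral mu1 (@far0 R P d) (fun z : borelRV R P =>
    (\- u) (x + j1 p z) - (\- u) x - dotv (- p) (j1 p z)) = - Lfar mu1 j1 d u p x.
  by rewrite -RintegralN//; apply: eq_Rintegral => z _; rewrite /integ1 dotvNl (dotvC p) /=; ring.
have -> : Rintegral mu2 (@punct R P) (fun z : borelRV R P =>
    (\- u) (x + j2 p z) - (\- u) x) = - L2 mu2 j2 u p x.
  by rewrite -RintegralN//; apply: eq_Rintegral => z _; rewrite /integ2 /=; ring.
by rewrite !opprD.
Qed.

Lemma visc_super_psuper u : continuous u -> visc_super u -> psuper u.
Proof.
move=> cu [bu [_ su]] x p C B l tg H; have [M uM] := bu; have [C0 tg1 tg2] := tg.
apply: (F_left_ge Fcont) => e e0.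
have [d d0 le] := splitting_of_below cu uM tg H e0.
have := su d (paraboloid (u x) p (- C) x) x d0 (paraboloid_C2 _ _ _ _) _
  (nonlocal_defined_paraboloid p x (- C) cu bu d0).
rewrite paraboloid_grad => Hs; apply: (le_trans (Hs _)).
  move=> y; rewrite /paraboloid subrr !dotv0r mulr0 !addr0 subrr.
  have := tg1 (y - x); rewrite /gap (addrC x) subrK /=; lra.
apply: Fmono; apply: (le_trans le).
have -> : Rintegral mu1 (@Defs.ball0 R P d) (fun z : borelRV R P => - C * dotv (j1 p z) (j1 p z)) =
    Lloc mu1 j1 d (paraboloid (u x) p (- C) x) x.
  rewrite /Lloc paraboloid_grad; apply: eq_Rintegral => z _.
  exact/esym/paraboloid_integ1.
by rewrite LfarE.
Qed.

End ViscosityEquivalence.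

(** * Existence and uniqueness for general [F], then for the two equations *)

Unset Implicit Arguments.
Set Strict Implicit.

Lemma well_posedness (R : realType) (N P : nat)
  (mu1 mu2 : {measure set (borelRV R P) -> \bar R})
  (j1 j2 : 'rV[R]_N -> 'rV[R]_P -> 'rV[R]_N)
  (F : R -> 'rV[R]_N -> R -> R) (f : 'rV[R]_N -> R) :
  borel_measurable (fun pz : 'rV[R]_N * 'rV[R]_P => j1 pz.1 pz.2) ->
  borel_measurable (fun pz : 'rV[R]_N * 'rV[R]_P => j2 pz.1 pz.2) ->
  hypM mu1 mu2 -> hypJ1 mu1 mu2 j1 j2 -> hypJ2 mu1 j1 ->
  hypF1 F -> hypF5 F f ->
  exists2 u, visc_sol mu1 mu2 j1 j2 F f u /\ boundedf u /\ unif_cont u &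
    forall v, visc_sol mu1 mu2 j1 j2 F f v -> v = u.
Proof.
move=> hj1 hj2 hM hJ1 hJ2 [Fcont Fmono] [[Mf fM] [fuc [[g g0 Hg] F3]]].
have F3' : hypF3 F.
  by move=> M r M0 /F3[w [mw Hw]]; exists w; split => //; exact: Hw.
(* The constant is independent of the bound on the arguments, so the bound [|u| + |v| + 1] gives
   monotonicity on the whole line. *)
have Fg (u v : R) p l : v <= u -> g * (u - v) <= F u p l - F v p l.
  move=> vu; have M0 : 0 < `|u| + `|v| + 1 by rewrite ltr_wpDl// addr_ge0.
  apply: (Hg _ M0) => //.
  - by have := ler_norm (- v); rewrite normrN; have := normr_ge0 u; lra.
  - by have := ler_norm u; have := normr_ge0 v; lra.
pose U := perron_sol mu1 mu2 j1 j2 F f g Mf.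
have cU : continuous U by exact: perron_sol_continuous.
have Ub : boundedf U.
  exists (perron_bound F g Mf) => x; rewrite ler_norml.
  exact: perron_sol_bound.
have Usub : parabolic_sub mu1 mu2 j1 j2 F f U by exact: perron_sol_psub.
have Usup : parabolic_super mu1 mu2 j1 j2 F f U by exact: perron_sol_psuper.
exists U.
  split; last by split => //; exact: perron_sol_unif_cont.
  split => //; split => //; split.
    exact: psub_visc_sub.
  exact: psuper_visc_super.
move=> v [vb [cv [vsub vsup]]].
have vsub' := visc_sub_psub hj1 hj2 hM hJ1 Fcont Fmono cv vsub.
have vsup' := visc_super_psuper hj1 hj2 hM hJ1 Fcont Fmono cv vsup.
apply/funext => x; apply: le_anti; apply/andP; split.
- exact: (comparison hj1 hj2 hM hJ1 hJ2 g0 Fg F3' fuc).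
- exact: (comparison hj1 hj2 hM hJ1 hJ2 g0 Fg F3' fuc).
Qed.

Theorem theorem2p3 (R : realType) (N P : nat) (hN : (0 < N)%N) (hP : (0 < P)%N)
  (mu1 mu2 : {measure set (borelRV R P) -> \bar R})
  (j1 j2 : 'rV[R]_N -> 'rV[R]_P -> 'rV[R]_N)
  (F : R -> 'rV[R]_N -> R -> R) (f : 'rV[R]_N -> R) :
  radon_punctured mu1 -> radon_punctured mu2 ->
  borel_measurable (fun pz : 'rV[R]_N * 'rV[R]_P => j1 pz.1 pz.2) ->
  borel_measurable (fun pz : 'rV[R]_N * 'rV[R]_P => j2 pz.1 pz.2) ->
  hypM mu1 mu2 -> hypJ1 mu1 mu2 j1 j2 -> hypJ2 mu1 j1 -> hypJ3 mu1 j1 ->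
  ( (hypF1 F -> hypF2 F -> hypF3 F -> hypF4 f -> hypF5 F f ->
      exists2 u, visc_sol mu1 mu2 j1 j2 F f u /\ boundedf u /\ unif_cont u &
        forall v, visc_sol mu1 mu2 j1 j2 F f v -> v = u)
  /\
    (hypF5 (fun (t : R) (_ : 'rV[R]_N) (l : R) => t - l) f ->
      exists2 u, visc_sol mu1 mu2 j1 j2 (fun t _ l => t - l) f u /\ unif_cont u &
        forall v, visc_sol mu1 mu2 j1 j2 (fun t _ l => t - l) f v ->
          unif_cont v -> v = u) ).
Proof.
move=> _ _ hj1 hj2 hM hJ1 hJ2 _; split.
  by move=> hF1 _ _ _ hF5; exact: well_posedness.
move=> hF5.
have hF1 : hypF1 (fun (t : R) (_ : 'rV[R]_N) (l : R) => t - l).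
  split; last by move=> u p l l' ll'; rewrite lerD2l lerN2.
  move=> z; apply: (@cvgB _ _ _ (nbhs z) _ (fun t => t.1.1) snd); last exact: cvg_snd.
  exact: (cvg_comp _ _ cvg_fst cvg_fst).
have [u [Hu [_ uc]] Hv] := @well_posedness R N P mu1 mu2 j1 j2 _ f hj1 hj2 hM hJ1 hJ2 hF1 hF5.
by exists u => // v sv _; exact: Hv.
Qed.
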